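(* Let $\mathcal{L}ie_{dg}$ be the category whose objects are dg Lie algebras and whose morphisms are $L_\infty$ morphisms. Let $\mathfrak{X}$ be a category and let $F\colon\mathcal{L}ie_{dg}\to\mathfrak{X}$ be a functor which maps every ($L_\infty$) quasi-isomorphism to an invertible morphism. Then for any dg Lie algebras $\mathfrak{g}_1,\mathfrak{g}_2$ and any two homotopic morphisms $\varphi_1,\varphi_2\in\mathrm{Mor}(\mathfrak{g}_1,\mathfrak{g}_2)$ of $\mathcal{L}ie_{dg}$ one has $F(\varphi_1)=F(\varphi_2)$.
   Context: Ground field $\mathbb{C}$; dg Lie algebras are $\mathbb{Z}$-graded (unbounded) with differential of degree $+1$; $V[n]^k=V^{n+k}$. For a dg Lie algebra $\mathfrak{g}$, $C(\mathfrak{g},\mathbb{C})=S(\mathfrak{g}[1])$ is its chain complex, a counital cocommutative dg coalgebra whose differential is built from the differential and the bracket of $\mathfrak{g}$; $C_+(\mathfrak{g},\mathbb{C})=\bigoplus_{n\ge1}S^n(\mathfrak{g}[1])$ is the kernel of the counit, with its (reduced) coproduct $\Delta$. An $L_\infty$ morphism $\mathfrak{g}_1\to\mathfrak{g}_2$ is a morphism of dg coalgebras $C_+(\mathfrak{g}_1,\mathbb{C})\to C_+(\mathfrak{g}_2,\mathbb{C})$; composition is composition of coalgebra maps. It is determined by its Taylor components $F_n\colon\Lambda^n(\mathfrak{g}_1)\to\mathfrak{g}_2[1-n]$, $n\ge1$; $F_1$ is a map of complexes, and the morphism is an $L_\infty$ quasi-isomorphism if $F_1$ induces an isomorphism on cohomology.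 The dg Lie algebra $\Bbbk(\mathfrak{g}_1,\mathfrak{g}_2)=\mathrm{Hom}_{\mathbb{C}}(C_+(\mathfrak{g}_1,\mathbb{C}),\mathfrak{g}_2)$ has the differential $d_{\Bbbk}$ induced by the differentials of $C_+(\mathfrak{g}_1,\mathbb{C})$ and $\mathfrak{g}_2$, and bracket $[\theta_1,\theta_2]$ given (with Koszul signs) by the composition $C_+(\mathfrak{g}_1,\mathbb{C})\xrightarrow{\Delta}C_+(\mathfrak{g}_1,\mathbb{C})^{\otimes2}\xrightarrow{\theta_1\otimes\theta_2}\mathfrak{g}_2\otimes\mathfrak{g}_2\xrightarrow{[\,,]}\mathfrak{g}_2$. The solutions $F\in\Bbbk(\mathfrak{g}_1,\mathfrak{g}_2)^1$ of the Maurer–Cartan equation $d_{\Bbbk}F+\frac12[F,F]=0$ correspond bijectively, via Taylor components, to the $L_\infty$ morphisms $\mathfrak{g}_1\to\mathfrak{g}_2$. For $H\in\Bbbk(\mathfrak{g}_1,\mathfrak{g}_2)^0$ and a Maurer–Cartan solution $F$, let $F_H=F(1)$, where $F(t)$ is the solution of $\frac{dF(t)}{dt}=-d_{\Bbbk}H+[H,F(t)]$, $F(0)=F$ (the flow exists since $\Bbbk(\mathfrak{g}_1,\mathfrak{g}_2)$ is pro-nilpotent with respect to the filtration by the arity $n$); formally $F_H+d_{\Bbbk}=\exp(\mathrm{ad}(H))(F+d_{\Bbbk})$, and $F_H$ is again a Maurer–Cartan solution. Two $L_\infty$ morphisms $F_1,F_2\colon\mathfrak{g}_1\to\mathfrak{g}_2$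 are homotopic if $F_2=(F_1)_H$ for some $H\in\Bbbk(\mathfrak{g}_1,\mathfrak{g}_2)^0$. *)

(* Defs.v *)
From HB Require Import structures.
From mathcomp Require Import all_boot all_order all_algebra.
From mathcomp Require Import boolp.
From mathcomp Require Import finmap generic_quotient ring_quotient.
From mathcomp Require Import monalg ring.

Set Implicit Arguments.
Unset Strict Implicit.
Unset Printing Implicit Defensive.

Import GRing.Theory.
Local Open Scope ring_scope.
Local Open Scope quotient_scope.

(* qmod rel is M / span(rel). With M = {malg K[X]}, the free module on X, this
   is the module presented by the generators X and the relations rel. *)
Section QuotientModule.
Variables (K : fieldType) (M : lmodType K) (rel : M -> Prop).

Inductive lspan : M -> Prop :=
| lspan0 : lspan 0
| lspan_gen r : rel r -> lspan r
| lspan_lin a u v : lspan u -> lspan v -> lspan (a *: u + v).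

Definition in_lspan : {pred M} := fun x => `[< lspan x >].

Lemma in_lspanP x : reflect (lspan x) (x \in in_lspan).
Proof. exact: asboolP. Qed.

Lemma in_lspan_zmod : zmod_closed in_lspan.
Proof.
split; first exact/in_lspanP/lspan0.
move=> x y /in_lspanP hx /in_lspanP hy; apply/in_lspanP.
by rewrite addrC -scaleN1r; apply: lspan_lin.
Qed.

HB.instance Definition _ := GRing.isZmodClosed.Build M in_lspan in_lspan_zmod.

Definition qmod : Type := Quotient.quot in_lspan.

HB.instance Definition _ := GRing.Zmodule.on qmod.

Definition qmk (x : M) : qmod := \pi_(Quotient.quot in_lspan) x.

Lemma qmk_eq x y : qmk x = qmk y <-> lspan (x - y).
Proof.
split=> [/eqP|h]; first by rewrite /qmk -Quotient.idealrBE => /in_lspanP.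
by apply/eqP; rewrite /qmk -Quotient.idealrBE; apply/in_lspanP.
Qed.

Lemma qmk_repr (q : qmod) : qmk (repr (q : Quotient.quot in_lspan)) = q.
Proof. exact: (reprK (q : Quotient.quot in_lspan)). Qed.

Lemma qmk_surj (q : qmod) : exists x, q = qmk x.
Proof. by exists (repr (q : Quotient.quot in_lspan)); rewrite qmk_repr. Qed.

Lemma qmkD x y : qmk (x + y) = qmk x + qmk y.
Proof.
by rewrite /qmk; exact: (raddfD (\pi_(Quotient.quot in_lspan))).
Qed.

Definition qscale (a : K) (q : qmod) : qmod :=
  qmk (a *: repr (q : Quotient.quot in_lspan)).

Lemma qscaleE a x : qscale a (qmk x) = qmk (a *: x).
Proof.
apply/qmk_eq; rewrite -scalerBr -[_ *: _]addr0.
by apply: lspan_lin lspan0; apply/qmk_eq; rewrite qmk_repr.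
Qed.

Lemma qscaleA a b q : qscale a (qscale b q) = qscale (a * b) q.
Proof. by have [x ->] := qmk_surj q; rewrite !qscaleE scalerA. Qed.
Lemma qscale1 : left_id 1 qscale.
Proof. by move=> q; have [x ->] := qmk_surj q; rewrite qscaleE scale1r. Qed.
Lemma qscaleDr : right_distributive qscale +%R.
Proof.
move=> a p q; have [x ->] := qmk_surj p; have [y ->] := qmk_surj q.
by rewrite -qmkD !qscaleE -qmkD scalerDr.
Qed.
Lemma qscaleDl q : {morph qscale^~ q : a b / a + b}.
Proof.
by move=> a b; have [x ->] := qmk_surj q; rewrite !qscaleE -qmkD scalerDl.
Qed.

HB.instance Definition _ :=
  GRing.Zmodule_isLmodule.Build K qmod qscaleA qscale1 qscaleDr qscaleDl.

Lemma qmk_linear : linear qmk.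
Proof. by move=> a x y; rewrite qmkD -qscaleE. Qed.

HB.instance Definition _ :=
  GRing.isLinear.Build K M qmod *:%R qmk qmk_linear.

Section Lift.
Variables (Z : lmodType K) (f : {linear M -> Z}).
Hypothesis f0 : forall r, rel r -> f r = 0.

Definition qlift_fun (q : qmod) : Z := f (repr (q : Quotient.quot in_lspan)).

Lemma qlift_funE x : qlift_fun (qmk x) = f x.
Proof.
have hs z : lspan z -> f z = 0.
  by elim=> [|r /f0//|a u v _ fu _ fv]; rewrite ?linear0 // linearP fu fv scaler0 addr0.
apply/eqP; rewrite -subr_eq0 -linearB /=; apply/eqP/hs.
by apply/qmk_eq; rewrite qmk_repr.
Qed.

Lemma qlift_linear : linear qlift_fun.
Proof.
move=> a p q; have [x ->] := qmk_surj p; have [y ->] := qmk_surj q.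
by rewrite -linearP !qlift_funE linearP.
Qed.

HB.instance Definition _ :=
  GRing.isLinear.Build K qmod Z *:%R qlift_fun qlift_linear.

Definition qlift : {linear qmod -> Z} := qlift_fun.

Lemma qliftE x : qlift (qmk x) = f x.
Proof. exact: qlift_funE. Qed.
End Lift.

End QuotientModule.

Section FreeModule.
Variables (K : fieldType) (X : choiceType) (Z : lmodType K) (f : X -> Z).

Definition flift_fun (g : {malg K[X]}) : Z :=
  \sum_(x <- msupp g) g@_x *: f x.

Lemma flift_funEw (g : {malg K[X]}) (D : {fset X}) :
  (msupp g `<=` D)%fset -> flift_fun g = \sum_(x <- D) g@_x *: f x.
Proof.
move=> /fsubsetP sD; rewrite /flift_fun.
rewrite [RHS](bigID (fun x => x \in msupp g)) /= [X in _ = _ + X]big1 ?addr0.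
  rewrite -[RHS]big_filter; apply/perm_big/uniq_perm.
  - exact: fset_uniq.
  - by rewrite filter_uniq ?fset_uniq.
  move=> x; rewrite mem_filter; case E: (x \in msupp g) => //=.
  by rewrite (sD _ E).
by move=> x /mcoeff_outdom ->; rewrite scale0r.
Qed.

Lemma flift_linear : linear flift_fun.
Proof.
move=> a u v.
pose D := (msupp u `|` msupp v `|` msupp (a *: u + v))%fset.
rewrite !(@flift_funEw _ D); first last.
- exact: fsubsetUr.
- by rewrite /D -fsetUA fsubsetUl.
- by rewrite /D fsetUAC fsubsetUr.
rewrite scaler_sumr -big_split /=; apply: eq_bigr => x _.
by rewrite mcoeffD mcoeffZ scalerDl scalerA.
Qed.

HB.instance Definition _ :=
  GRing.isLinear.Build K {malg K[X]} Z *:%R flift_fun flift_linear.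

Definition flift : {linear {malg K[X]} -> Z} := flift_fun.

Lemma fliftU x : flift (mkmalgU x 1) = f x.
Proof.
rewrite /flift /= (@flift_funEw _ [fset x]%fset).
  by rewrite big_seq_fset1 mcoeffUU scale1r.
by apply/fsubsetP=> y; rewrite msuppU oner_eq0.
Qed.
End FreeModule.

Lemma presented_ind (K : fieldType) (X : choiceType)
    (rel : {malg K[X]} -> Prop) (P : qmod rel -> Prop) :
  P 0 -> (forall a x y, P x -> P y -> P (a *: x + y)) ->
  (forall x, P (qmk rel (mkmalgU x 1))) -> forall q, P q.
Proof.
move=> P0 PD Px q; have [g ->] := qmk_surj q.
rewrite [g]monalgE linear_sum; elim: (enum_fset _) => [|x s IH].
  by rewrite big_nil.
rewrite big_cons; have -> : mkmalgU x g@_x = g@_x *: mkmalgU x 1.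
  apply/malgP=> y; rewrite mcoeffZ !mcoeffU.
  by case: (x == y); rewrite ?mulr1 ?mulr0.
by rewrite linearZ; apply: PD => //; apply: Px.
Qed.

Section Tensor.
Variables (K : fieldType) (U W : lmodType K).

Local Notation pair u w := (mkmalgU (u, w) 1 : {malg K[(U * W)%type]}).

Inductive tensor_rel : {malg K[(U * W)%type]} -> Prop :=
| tensor_rel_l a u u' w :
    tensor_rel (pair (a *: u + u') w - (a *: pair u w + pair u' w))
| tensor_rel_r a u w w' :
    tensor_rel (pair u (a *: w + w') - (a *: pair u w + pair u w')).

Definition tensor : lmodType K := qmod tensor_rel.

Definition tens (u : U) (w : W) : tensor := qmk tensor_rel (pair u w).

Lemma tens_linl w : linear (tens^~ w).
Proof.
move=> a u v; rewrite /tens -linearP; apply/qmk_eq/lspan_gen.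
exact: tensor_rel_l.
Qed.

Lemma tens_linr u : linear (tens u).
Proof.
move=> a w v; rewrite /tens -linearP; apply/qmk_eq/lspan_gen.
exact: tensor_rel_r.
Qed.

Definition tensl_fun w (u : U) : tensor := tens u w.
Definition tensr_fun u (w : W) : tensor := tens u w.

HB.instance Definition _ w :=
  GRing.isLinear.Build K U tensor *:%R (tensl_fun w) (tens_linl w).
HB.instance Definition _ u :=
  GRing.isLinear.Build K W tensor *:%R (tensr_fun u) (tens_linr u).

Definition tensl w : {linear U -> tensor} := tensl_fun w.
Definition tensr u : {linear W -> tensor} := tensr_fun u.

Lemma tensor_ind (P : tensor -> Prop) :
  P 0 -> (forall a x y, P x -> P y -> P (a *: x + y)) ->
  (forall u w, P (tens u w)) -> forall x, P x.
Proof.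
by move=> P0 PD Pt; apply: presented_ind => // -[u w]; apply: Pt.
Qed.

Lemma tensor_ext (Z : lmodType K) (f f' : {linear tensor -> Z}) :
  (forall u w, f (tens u w) = f' (tens u w)) -> f =1 f'.
Proof.
move=> h x; elim/tensor_ind: x => [|a x y hx hy|//].
  by rewrite !linear0.
by rewrite !linearP hx hy.
Qed.

Section Lift.
Variables (Z : lmodType K) (b : U -> W -> Z).
Hypotheses (bl : forall w, linear (b^~ w)) (br : forall u, linear (b u)).

Lemma tlift_subproof r :
  tensor_rel r -> flift (fun p : U * W => b p.1 p.2) r = 0.
Proof.
by case=> *; rewrite linearB linearP !fliftU /= ?bl ?br subrr.
Qed.

Definition tlift : {linear tensor -> Z} := qlift tlift_subproof.

Lemma tliftE u w : tlift (tens u w) = b u w.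
Proof. by rewrite /tlift /tens qliftE fliftU. Qed.
End Lift.
End Tensor.

Arguments tensl {K U W}.
Arguments tensr {K U W}.
#[global] Opaque tensor tens tlift.
#[global] Opaque qlift flift.

Section TensorMap.
Variables (K : fieldType) (U U' W W' : lmodType K).
Variables (f : {linear U -> U'}) (g : {linear W -> W'}).

Lemma tmap_linl w : linear (fun u => tens (f u) (g w)).
Proof. by move=> a u v; rewrite linearP tens_linl. Qed.
Lemma tmap_linr u : linear (fun w => tens (f u) (g w)).
Proof. by move=> a w v; rewrite linearP tens_linr. Qed.

Definition tmap : {linear tensor U W -> tensor U' W'} :=
  tlift tmap_linl tmap_linr.

Lemma tmapE u w : tmap (tens u w) = tens (f u) (g w).
Proof. exact: tliftE. Qed.
End TensorMap.

Lemma tmap_id (K : fieldType) (U W : lmodType K) :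
  tmap (idfun : {linear U -> U}) (idfun : {linear W -> W}) =1 id.
Proof. by apply: (tensor_ext (f' := idfun)) => u w; rewrite tmapE. Qed.

Lemma tmap_comp (K : fieldType) (U U' U'' W W' W'' : lmodType K)
    (f : {linear U -> U'}) (f' : {linear U' -> U''})
    (g : {linear W -> W'}) (g' : {linear W' -> W''}) :
  tmap (f' \o f) (g' \o g) =1 tmap f' g' \o tmap f g.
Proof. by apply: tensor_ext => u w /=; rewrite !tmapE. Qed.

(* The Koszul sign (-1)^n. *)
Definition sg (K : fieldType) (n : int) : K := (-1) ^ n.
Arguments sg : clear implicits.

Lemma sgD (K : fieldType) m n : sg K (m + n) = sg K m * sg K n.
Proof. by rewrite /sg exprzDr ?unitrN1. Qed.

Lemma sgN (K : fieldType) n : sg K (- n) = sg K n.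
Proof. by rewrite /sg -exprz_inv invrN1. Qed.

Lemma sgsq (K : fieldType) n : sg K n * sg K n = 1.
Proof. by rewrite -{2}sgN -sgD subrr. Qed.

Lemma sg1 (K : fieldType) : sg K 1 = -1.
Proof. by rewrite /sg expr1z. Qed.

Lemma sg_odd (K : fieldType) n : sg K n = (-1) ^+ odd `|n|%N.
Proof.
rewrite signr_odd; case: (intP n) => [//|m|m]; first by rewrite absz_nat.
by rewrite sgN abszN absz_nat.
Qed.

Lemma sg_or (K : fieldType) n : sg K n = 1 \/ sg K n = -1.
Proof. by rewrite sg_odd; case: odd; rewrite ?expr1 ?expr0; [right|left]. Qed.

Lemma sgMM (K : fieldType) n : sg K (n * n) = sg K n.
Proof. by rewrite !sg_odd abszM oddM andbb. Qed.

(* A Z-graded vector space V = (+)_k V^k, the grading being recorded by the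
   projections gpr k onto V^k along the other summands. *)
Record gmod (K : fieldType) := GMod {
  gcar :> lmodType K;
  gpr : int -> {linear gcar -> gcar};
  gprI : forall i j x, gpr i (gpr j x) = if i == j then gpr j x else 0;
  gpr_sum : forall x, exists2 s : seq int, uniq s & x = \sum_(i <- s) gpr i x }.

Definition homog (K : fieldType) (V : gmod K) (i : int) (x : V) : Prop :=
  gpr V i x = x.

Definition has_degree (K : fieldType) (V W : gmod K) (p : int)
    (f : {linear V -> W}) : Prop :=
  forall i x, f (gpr V i x) = gpr W (i + p) (f x).

(* shift n V is V[n]: V[n]^k = V^(n + k) on the same underlying space. *)
Section Shift.
Variables (K : fieldType) (n : int) (V : gmod K).

Definition shift_pr (k : int) : {linear V -> V} := gpr V (n + k).

Lemma shift_prI i j x :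
  shift_pr i (shift_pr j x) = if i == j then shift_pr j x else 0.
Proof. by rewrite /shift_pr gprI (inj_eq (addrI n)). Qed.

Lemma shift_pr_sum x :
  exists2 s : seq int, uniq s & x = \sum_(i <- s) shift_pr i x.
Proof.
have [s us {1}->] := gpr_sum x.
exists [seq i - n | i <- s]; first by rewrite map_inj_uniq //; apply: addIr.
rewrite big_map; apply: eq_bigr => i _.
by rewrite /shift_pr addrC subrK.
Qed.

Definition shift : gmod K := GMod shift_prI shift_pr_sum.
End Shift.

(* symp V is (+)_(n >= 1) S^n(V), S^n in the graded-commutative sense. The letter
   (k, v) stands for the degree k component of v, hence sym_rel_pr; word w is the
   product of the letters of w. The relation sym_rel_nil removes S^0. *)
Section SymmetricCoalgebra.
Variables (K : fieldType) (V : gmod K).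

Definition letter : Type := (int * V)%type.
Definition wdeg (w : seq letter) : int := \sum_(l <- w) l.1.

Local Notation gen w := (mkmalgU w 1 : {malg K[seq (int * V)%type]}).

Inductive sym_rel : {malg K[seq (int * V)%type]} -> Prop :=
| sym_rel_nil : sym_rel (gen [::])
| sym_rel_lin s1 s2 k a u v :
    sym_rel (gen (s1 ++ (k, a *: u + v) :: s2)
             - (a *: gen (s1 ++ (k, u) :: s2) + gen (s1 ++ (k, v) :: s2)))
| sym_rel_pr s1 s2 k u :
    sym_rel (gen (s1 ++ (k, u) :: s2) - gen (s1 ++ (k, gpr V k u) :: s2))
| sym_rel_swap s1 s2 k l u v :
    sym_rel (gen (s1 ++ (k, u) :: (l, v) :: s2)
             - sg K (k * l) *: gen (s1 ++ (l, v) :: (k, u) :: s2)).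

Definition symp_car : lmodType K := qmod sym_rel.

Definition word (w : seq letter) : symp_car := qmk sym_rel (gen w).

(* Functions on words compatible with every relation but sym_rel_nil. *)
Record symmultilinear (Z : lmodType K) (f : seq letter -> Z) : Prop := SymMultilinear {
  sml_lin : forall s1 s2 k a u v, f (s1 ++ (k, a *: u + v) :: s2)
    = a *: f (s1 ++ (k, u) :: s2) + f (s1 ++ (k, v) :: s2);
  sml_pr : forall s1 s2 k u,
    f (s1 ++ (k, u) :: s2) = f (s1 ++ (k, gpr V k u) :: s2);
  sml_swap : forall s1 s2 k l u v, f (s1 ++ (k, u) :: (l, v) :: s2)
    = sg K (k * l) *: f (s1 ++ (l, v) :: (k, u) :: s2) }.

Lemma word_nil : word [::] = 0.
Proof.
rewrite /word -(linear0 (qmk sym_rel)); apply/qmk_eq; rewrite subr0.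
exact/lspan_gen/sym_rel_nil.
Qed.

Lemma word_sml : symmultilinear word.
Proof.
split=> *; rewrite /word -?linearP -?linearZ; apply/qmk_eq/lspan_gen.
- exact: sym_rel_lin.
- exact: sym_rel_pr.
- exact: sym_rel_swap.
Qed.

Section Lift.
Variables (Z : lmodType K) (f : seq letter -> Z).
Hypotheses (f0 : f [::] = 0) (fsml : symmultilinear f).

Lemma symlift_subproof r : sym_rel r -> flift f r = 0.
Proof.
case: fsml => fl fp fs.
case=> [|s1 s2 k a u v|s1 s2 k u|s1 s2 k l u v].
- by rewrite fliftU.
- by rewrite linearB linearP !fliftU fl subrr.
- by rewrite linearB !fliftU -fp subrr.
- by rewrite linearB linearZ_LR !fliftU fs subrr.
Qed.

Definition symlift : {linear symp_car -> Z} := qlift symlift_subproof.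

Lemma symliftE w : symlift (word w) = f w.
Proof. by rewrite /symlift /word qliftE fliftU. Qed.
End Lift.

Lemma symp_ind (P : symp_car -> Prop) :
  P 0 -> (forall a x y, P x -> P y -> P (a *: x + y)) ->
  (forall w, P (word w)) -> forall x, P x.
Proof. exact: presented_ind. Qed.

Lemma symp_ext (Z : lmodType K) (f g : {linear symp_car -> Z}) :
  (forall w, f (word w) = g (word w)) -> f =1 g.
Proof.
move=> h x; elim/symp_ind: x => [|a x y hx hy|//]; first by rewrite !linear0.
by rewrite !linearP hx hy.
Qed.

Lemma wdeg_cons l w : wdeg (l :: w) = l.1 + wdeg w.
Proof. by rewrite /wdeg big_cons. Qed.

Lemma wdeg_cat s1 s2 : wdeg (s1 ++ s2) = wdeg s1 + wdeg s2.
Proof. by rewrite /wdeg big_cat. Qed.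

Section Closure.
Variable Z : lmodType K.
Implicit Types f : seq letter -> Z.

Lemma sml_cons f x : symmultilinear f -> symmultilinear (fun w => f (x :: w)).
Proof.
case=> fl fp fs; split=> s1 *; rewrite -!cat_cons.
- exact: fl.
- exact: fp.
- exact: fs.
Qed.

Lemma sml_wdeg f (c : int -> K) :
  symmultilinear f -> symmultilinear (fun w => c (wdeg w) *: f w).
Proof.
case=> fl fp fs; split=> [s1 s2 k a u v|s1 s2 k u|s1 s2 k l u v];
  rewrite !(wdeg_cat, wdeg_cons) /=.
- by rewrite fl scalerDr !scalerA [c _ * _]mulrC.
- by rewrite fp.
- by rewrite fs !scalerA mulrC [k + (l + _)]addrCA.
Qed.

Lemma sml_lincomb f g a : symmultilinear f -> symmultilinear g ->
  symmultilinear (fun w => a *: f w + g w).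
Proof.
case=> fl fp fs [gl gp gs]; split=> *.
- rewrite fl gl !scalerDr !scalerA addrACA; congr (_ + _ + _).
  by rewrite mulrC.
- by rewrite fp gp.
- by rewrite fs gs scalerDr !scalerA mulrC.
Qed.

Lemma sml0 f s1 s2 k : symmultilinear f -> f (s1 ++ (k, 0) :: s2) = 0.
Proof.
move=> hf; have /eqP := sml_lin hf s1 s2 k 1 0 0.
by rewrite !scale1r addr0 -subr_eq0 opprD addNKr oppr_eq0 => /eqP.
Qed.

Lemma smlZ f s1 s2 k a u : symmultilinear f ->
  f (s1 ++ (k, a *: u) :: s2) = a *: f (s1 ++ (k, u) :: s2).
Proof. by move=> hf; rewrite -[a *: u]addr0 (sml_lin hf) sml0 // addr0. Qed.

End Closure.

Lemma sml_comp (Z Z' : lmodType K) (h : {linear Z -> Z'}) f :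
  symmultilinear f -> symmultilinear (fun w => h (f w)).
Proof.
case=> fl fp fs; split=> *.
- by rewrite fl linearP.
- by rewrite fp.
- by rewrite fs linearZ.
Qed.

Definition wscale (c : int -> K) : {linear symp_car -> symp_car} :=
  @symlift _ (fun w => c (wdeg w) *: word w)
    (etrans (congr1 _ word_nil) (scaler0 _ _)) (sml_wdeg c word_sml).

Lemma wscaleE c w : wscale c (word w) = c (wdeg w) *: word w.
Proof. exact: symliftE. Qed.

Definition symp_pr (n : int) : {linear symp_car -> symp_car} :=
  wscale (fun m => (m == n)%:R).

Lemma symp_prI i j x :
  symp_pr i (symp_pr j x) = if i == j then symp_pr j x else 0.
Proof.
elim/symp_ind: x => [|a x y hx hy|w].
- by rewrite !linear0 if_same.
- by rewrite !linearP hx hy; case: eqP; rewrite ?scaler0 ?addr0.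
rewrite /symp_pr !wscaleE linearZ_LR wscaleE.
have [->|ne] := eqVneq i j; first by case: eqP => _; rewrite ?scale1r ?scale0r.
by case: eqP => [->|_]; rewrite ?scale0r // eq_sym (negPf ne) scale0r scaler0.
Qed.

Lemma symp_pr_sum x :
  exists2 s : seq int, uniq s & x = \sum_(i <- s) symp_pr i x.
Proof.
suff [s us hs] : exists2 s : seq int, uniq s &
    forall t, uniq t -> {subset s <= t} -> x = \sum_(i <- t) symp_pr i x.
  by exists s => //; apply: hs.
elim/symp_ind: x => [|a x y [s us hs] [t ut ht]|w].
- by exists [::] => // t _ _; rewrite big1 // => i _; rewrite linear0.
- exists (undup (s ++ t)); first exact: undup_uniq.
  move=> r ur sr.
  have hsr : {subset s <= r}.
    by move=> i si; apply: sr; rewrite mem_undup mem_cat si.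
  have htr : {subset t <= r}.
    by move=> i ti; apply: sr; rewrite mem_undup mem_cat ti orbT.
  under eq_bigr do rewrite linearP.
  rewrite big_split -scaler_sumr /=; congr (_ *: _ + _).
    exact: hs.
  exact: ht.
exists [:: wdeg w] => // r ur sr.
rewrite /symp_pr (bigD1_seq (wdeg w)) ?sr ?inE // wscaleE eqxx scale1r big1 /= ?addr0 // => i; rewrite eq_sym => /negPf ne.
by rewrite wscaleE ne scale0r.
Qed.

Definition symp : gmod K := GMod symp_prI symp_pr_sum.

(* Pairs of complementary subwords (a, b) of w with their Koszul sign: the
   coproduct of w in S(V) is the signed sum of the a (x) b, computed from
   Delta(x w) = (x (x) 1 + 1 (x) x) Delta(w). In symp V the empty word is zero, so
   that the pairs with a or b empty vanish and symp_delta below is the reduced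
   coproduct. *)
Fixpoint unshuffles (w : seq letter) : seq (K * (seq letter * seq letter)) :=
  if w is x :: w' then
    [seq (t.1, (x :: t.2.1, t.2.2)) | t <- unshuffles w'] ++
    [seq (sg K (x.1 * wdeg t.2.1) * t.1, (t.2.1, x :: t.2.2))
    | t <- unshuffles w']
  else [:: (1, ([::], [::]))].

Section Unshuffle.
Variable Z : lmodType K.
Implicit Types G : seq letter -> seq letter -> Z.

Definition unsh_sum G w : Z :=
  \sum_(t <- unshuffles w) t.1 *: G t.2.1 t.2.2.

Lemma unsh_sum_cons G x w : unsh_sum G (x :: w) =
  unsh_sum (fun a b => G (x :: a) b) w
  + unsh_sum (fun a b => sg K (x.1 * wdeg a) *: G a (x :: b)) w.
Proof.
rewrite /unsh_sum /= big_cat !big_map; congr (_ + _).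
by apply: eq_bigr => t _ /=; rewrite scalerA mulrC.
Qed.

Lemma eq_unsh_sum G G' w : (forall a b, G a b = G' a b) ->
  unsh_sum G w = unsh_sum G' w.
Proof. by move=> h; apply: eq_bigr => t _; rewrite h. Qed.

Lemma unsh_sum_lin G G' c w :
  unsh_sum (fun a b => c *: G a b + G' a b) w
  = c *: unsh_sum G w + unsh_sum G' w.
Proof.
rewrite /unsh_sum scaler_sumr -big_split; apply: eq_bigr => t _ /=.
by rewrite scalerDr !scalerA [c * _]mulrC.
Qed.

Lemma unsh_sumD G G' w :
  unsh_sum (fun a b => G a b + G' a b) w = unsh_sum G w + unsh_sum G' w.
Proof.
rewrite -[X in X + _]scale1r -unsh_sum_lin; apply: eq_unsh_sum => a b.
by rewrite scale1r.
Qed.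

Lemma unsh_sumZ G c w :
  unsh_sum (fun a b => c *: G a b) w = c *: unsh_sum G w.
Proof.
by rewrite /unsh_sum scaler_sumr; apply: eq_bigr => t _; rewrite !scalerA mulrC.
Qed.

Definition bisml G := (forall b, symmultilinear (G^~ b)) /\
  (forall a, symmultilinear (G a)).

Lemma bisml_l G x : bisml G -> bisml (fun a b => G (x :: a) b).
Proof. by case=> h1 h2; split=> [b|a] //; apply: sml_cons (h1 b). Qed.

Lemma bisml_r G x :
  bisml G -> bisml (fun a b => sg K (x.1 * wdeg a) *: G a (x :: b)).
Proof.
case=> h1 h2; split=> [b|a].
  exact: (sml_wdeg (fun n => sg K (x.1 * n)) (h1 (x :: b))).
have := sml_comp ( *:%R (sg K (x.1 * wdeg a)) : {linear Z -> Z}) (sml_cons x (h2 a)).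
exact.
Qed.

Lemma unsh_sum_sml G : bisml G -> symmultilinear (unsh_sum G).
Proof.
move=> hG; split=> s1 s2.
- move=> k a u v; elim: s1 G hG => [|x s1 IH] G hG; last first.
    rewrite !cat_cons !unsh_sum_cons scalerDr addrACA; congr (_ + _).
      exact: IH (bisml_l x hG).
    exact: IH (bisml_r x hG).
  rewrite /= !unsh_sum_cons scalerDr addrACA -!unsh_sum_lin /=; congr (_ + _).
    by apply: eq_unsh_sum => c d; apply: (sml_lin (hG.1 d) [::]).
  apply: eq_unsh_sum => c d.
  by rewrite (sml_lin (hG.2 c) [::]) scalerDr !scalerA mulrC.
- move=> k u; elim: s1 G hG => [|x s1 IH] G hG; last first.
    rewrite !cat_cons !unsh_sum_cons; congr (_ + _).
      exact: IH (bisml_l x hG).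
    exact: IH (bisml_r x hG).
  rewrite /= !unsh_sum_cons; congr (_ + _); apply: eq_unsh_sum => c d.
    exact: (sml_pr (hG.1 d) [::]).
  by rewrite (sml_pr (hG.2 c) [::]).
- move=> k l u v; elim: s1 G hG => [|x s1 IH] G hG; last first.
    rewrite !cat_cons !unsh_sum_cons scalerDr; congr (_ + _).
      exact: IH (bisml_l x hG).
    exact: IH (bisml_r x hG).
  rewrite /= !unsh_sum_cons -!unsh_sumD -unsh_sumZ; apply: eq_unsh_sum => c d /=.
  rewrite !wdeg_cons /= (sml_swap (hG.1 d) [::]) (sml_swap (hG.2 c) [::]) /=.
  rewrite !mulrDr !sgD !scalerDr !scalerA -!addrA; congr (_ + _).
  rewrite addrCA; congr (_ + (_ + _)); congr (_ *: _).
  + by rewrite [l * k]mulrC mulrA sgsq mul1r.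
  + by rewrite mulrC [sg K (l * _) * _]mulrC.
Qed.
End Unshuffle.

Lemma tens_word_bisml : bisml (fun a b => tens (word a) (word b)).
Proof.
split=> [b|a].
  have := sml_comp (tensl (word b)) word_sml; exact.
have := sml_comp (tensr (word a)) word_sml; exact.
Qed.

Definition delta_word (w : seq letter) : tensor symp_car symp_car :=
  unsh_sum (fun a b => tens (word a) (word b)) w.

Lemma delta_word_nil : delta_word [::] = 0.
Proof.
rewrite /delta_word /unsh_sum big_seq1 scale1r word_nil.
exact: (linear0 (tensl (0 : symp_car))).
Qed.

Definition symp_delta : {linear symp -> tensor symp symp} :=
  symlift delta_word_nil (unsh_sum_sml tens_word_bisml).

Lemma symp_deltaE w : symp_delta (word w) = delta_word w.
Proof. exact: symliftE. Qed.

End SymmetricCoalgebra.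

#[global] Opaque symp_car word symlift.

(* Only used in characteristic 0, where antisymmetry and the Jacobi identity
   need no supplement. *)
Record dgLie (K : fieldType) := DGLie {
  dgl_gmod :> gmod K;
  dgl_d : {linear dgl_gmod -> dgl_gmod};
  dgl_br : dgl_gmod -> dgl_gmod -> dgl_gmod;
  dgl_d_deg : has_degree 1 dgl_d;
  dgl_dd : forall x, dgl_d (dgl_d x) = 0;
  dgl_br_linl : forall y, linear (dgl_br^~ y);
  dgl_br_linr : forall x, linear (dgl_br x);
  dgl_br_deg : forall i j x y, homog i x -> homog j y ->
    homog (i + j) (dgl_br x y);
  dgl_antisym : forall i j x y, homog i x -> homog j y ->
    dgl_br x y = - (sg K (i * j) *: dgl_br y x);
  dgl_jacobi : forall i j x y z, homog i x -> homog j y ->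
    dgl_br x (dgl_br y z)
    = dgl_br (dgl_br x y) z + sg K (i * j) *: dgl_br y (dgl_br x z);
  dgl_leibniz : forall i x y, homog i x ->
    dgl_d (dgl_br x y) = dgl_br (dgl_d x) y + sg K i *: dgl_br x (dgl_d y) }.

(* cbar g is C_+(g) = (+)_(n >= 1) S^n(g[1]). A letter (k, x) of degree k in g[1]
   has degree k + 1 in g. The differential is the coderivation with components
   x |-> - d x and x y |-> (-1)^|x| [x, y], |x| the degree in g; with these signs
   the projection corest : C_+(g) -> g, of degree 1, satisfies the Maurer-Cartan
   equation of Hom(C_+(g), g). *)
Section ChevalleyEilenberg.
Variables (K : fieldType) (g : dgLie K).

Local Notation g1 := (shift 1 g).
Local Notation L := (letter g1).

Definition cbar : gmod K := symp g1.

Definition letter_d (x : L) : L := (x.1 + 1, - dgl_d g x.2).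

Definition letter_br (x y : L) : L :=
  (x.1 + y.1 + 1,
   sg K (x.1 + 1) *: dgl_br (gpr g (1 + x.1) x.2) (gpr g (1 + y.1) y.2)).

(* The sum over j of the terms in which x is moved next to the j-th letter of w
   and bracketed with it: w |-> {x, w} is a derivation of degree
   |x| + 1, where |x| is the degree in g[1]. *)
Fixpoint br_terms (x : L) (w : seq L) : seq (K * seq L) :=
  if w is y :: w' then
    (1, letter_br x y :: w') ::
    [seq (sg K ((x.1 + 1) * y.1) * t.1, y :: t.2) | t <- br_terms x w']
  else [::].

(* D(x w) = (- d x) w + (-1)^|x| x D(w) + {x, w}, with |x| the degree in g[1]. *)
Fixpoint d_terms (w : seq L) : seq (K * seq L) :=
  if w is x :: w' then
    (1, letter_d x :: w') ::
    [seq (sg K x.1 * t.1, x :: t.2) | t <- d_terms w'] ++ br_terms x w'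
  else [::].

Section Sum.
Variable Z : lmodType K.
Implicit Types f : seq L -> Z.

Definition br_sum f x w : Z := \sum_(t <- br_terms x w) t.1 *: f t.2.
Definition d_sum f w : Z := \sum_(t <- d_terms w) t.1 *: f t.2.

Lemma br_sum_cons f x y w : br_sum f x (y :: w) = f (letter_br x y :: w)
  + sg K ((x.1 + 1) * y.1) *: br_sum (fun w => f (y :: w)) x w.
Proof.
rewrite /br_sum /= big_cons big_map scale1r scaler_sumr; congr (_ + _).
by apply: eq_bigr => t _ /=; rewrite scalerA.
Qed.

Lemma d_sum_cons f x w : d_sum f (x :: w) = f (letter_d x :: w)
  + (sg K x.1 *: d_sum (fun w => f (x :: w)) w + br_sum f x w).
Proof.
rewrite /d_sum /= big_cons big_cat big_map scale1r scaler_sumr; congr (_ + (_ + _)).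
by apply: eq_bigr => t _ /=; rewrite scalerA.
Qed.

Lemma br_sum_lin f f' c x w :
  br_sum (fun w => c *: f w + f' w) x w = c *: br_sum f x w + br_sum f' x w.
Proof.
rewrite /br_sum scaler_sumr -big_split; apply: eq_bigr => t _ /=.
by rewrite scalerDr !scalerA [c * _]mulrC.
Qed.

Lemma br_sumZ f c x w : br_sum (fun w => c *: f w) x w = c *: br_sum f x w.
Proof.
by rewrite /br_sum scaler_sumr; apply: eq_bigr => t _; rewrite !scalerA mulrC.
Qed.

Lemma eq_br_sum f f' x w : f =1 f' -> br_sum f x w = br_sum f' x w.
Proof. by move=> h; apply: eq_bigr => t _; rewrite h. Qed.

Lemma d_sum_lin f f' c w :
  d_sum (fun w => c *: f w + f' w) w = c *: d_sum f w + d_sum f' w.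
Proof.
rewrite /d_sum scaler_sumr -big_split; apply: eq_bigr => t _ /=.
by rewrite scalerDr !scalerA [c * _]mulrC.
Qed.

Lemma d_sumZ f c w : d_sum (fun w => c *: f w) w = c *: d_sum f w.
Proof.
by rewrite /d_sum scaler_sumr; apply: eq_bigr => t _; rewrite !scalerA mulrC.
Qed.

Lemma eq_d_sum f f' w : f =1 f' -> d_sum f w = d_sum f' w.
Proof. by move=> h; apply: eq_bigr => t _; rewrite h. Qed.

Lemma letter_br_linr f x k a u v w : symmultilinear f ->
  f (letter_br x (k, a *: u + v) :: w)
  = a *: f (letter_br x (k, u) :: w) + f (letter_br x (k, v) :: w).
Proof.
move=> hf; rewrite /letter_br /= linearP dgl_br_linr scalerDr scalerA mulrC -scalerA.
exact: (sml_lin hf [::]).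
Qed.

Lemma letter_br_linl f k a u v y w : symmultilinear f ->
  f (letter_br (k, a *: u + v) y :: w)
  = a *: f (letter_br (k, u) y :: w) + f (letter_br (k, v) y :: w).
Proof.
move=> hf; rewrite /letter_br /= linearP dgl_br_linl scalerDr scalerA mulrC -scalerA.
exact: (sml_lin hf [::]).
Qed.

Lemma letter_br_prr x k u : letter_br x (k, u) = letter_br x (k, gpr g1 k u).
Proof. by rewrite /letter_br /= /shift_pr gprI eqxx. Qed.

Lemma letter_br_prl y k u : letter_br (k, u) y = letter_br (k, gpr g1 k u) y.
Proof. by rewrite /letter_br /= /shift_pr gprI eqxx. Qed.

Lemma letter_br_swap f x y w : symmultilinear f ->
  f (letter_br x y :: w) = sg K (x.1 * y.1) *: f (letter_br y x :: w).
Proof.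
case: x y => [k u] [l v] hf; rewrite /letter_br /= [l + k]addrC.
rewrite (dgl_antisym (i := 1 + k) (j := 1 + l)); first last.
- by rewrite /homog gprI eqxx.
- by rewrite /homog gprI eqxx.
rewrite -scaleNr !scalerA !(smlZ [::]) // scalerA; congr (_ *: _).
rewrite mulrDl !mulrDr !mul1r !mulr1 !sgD sg1.
by case: (sg_or K k) => ->; ring.
Qed.

Lemma letter_d_lin f k a u v w : symmultilinear f ->
  f (letter_d (k, a *: u + v) :: w)
  = a *: f (letter_d (k, u) :: w) + f (letter_d (k, v) :: w).
Proof.
move=> hf; rewrite /letter_d /= linearP opprD -scalerN.
exact: (sml_lin hf [::]).
Qed.

Lemma letter_d_pr f k u w : symmultilinear f ->
  f (letter_d (k, u) :: w) = f (letter_d (k, gpr g1 k u) :: w).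
Proof.
move=> hf; rewrite /letter_d /= /shift_pr dgl_d_deg -addrA -(linearN (gpr g _)).
exact: (sml_pr hf [::]).
Qed.

Lemma br_sum_linl f k a u v w : symmultilinear f ->
  br_sum f (k, a *: u + v) w
  = a *: br_sum f (k, u) w + br_sum f (k, v) w.
Proof.
elim: w f => [|y w IH] f hf; first by rewrite /br_sum !big_nil scaler0 addr0.
rewrite !br_sum_cons letter_br_linl // IH; last exact: sml_cons.
by rewrite !scalerDr !scalerA [a * _]mulrC addrACA.
Qed.

Lemma br_sum_prl f k u w : symmultilinear f ->
  br_sum f (k, u) w = br_sum f (k, gpr g1 k u) w.
Proof.
elim: w f => [|y w IH] f hf; first by rewrite /br_sum !big_nil.
by rewrite !br_sum_cons letter_br_prl IH //; apply: sml_cons.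
Qed.

Lemma br_sum_sml f x : symmultilinear f -> symmultilinear (br_sum f x).
Proof.
move=> hf; split=> s1 s2.
- move=> k a u v; elim: s1 f hf => [|y s1 IH] f hf; last first.
    rewrite !cat_cons !br_sum_cons scalerDr addrACA.
    rewrite (sml_lin hf (_ :: s1)) IH; last exact: sml_cons.
    by rewrite scalerDr !scalerA [a * _]mulrC.
  rewrite /= !br_sum_cons letter_br_linr // scalerDr addrACA; congr (_ + _).
  rewrite scalerA [a * _]mulrC -scalerA -scalerDr; congr (_ *: _).
  rewrite -br_sum_lin; apply: eq_br_sum => w.
  exact: (sml_lin hf [::]).
- move=> k u; elim: s1 f hf => [|y s1 IH] f hf; last first.
    rewrite !cat_cons !br_sum_cons (sml_pr hf (_ :: s1)) IH //.
    exact: sml_cons.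
  rewrite /= !br_sum_cons letter_br_prr; congr (_ + _ *: _).
  by apply: eq_br_sum => w; apply: (sml_pr hf [::]).
- move=> k l u v; elim: s1 f hf => [|y s1 IH] f hf; last first.
    rewrite !cat_cons !br_sum_cons (sml_swap hf (_ :: s1)) IH; last exact: sml_cons.
    by rewrite scalerDr !scalerA [sg K (k * l) * _]mulrC.
  rewrite /= !br_sum_cons /= !scalerDr !scalerA.
  rewrite (@eq_br_sum _
    (fun w => sg K (k * l) *: f ((l, v) :: (k, u) :: w))); last first.
    by move=> w; apply: (sml_swap hf [::]).
  rewrite br_sumZ scalerA.
  rewrite (sml_swap hf [::] _ (_ + _)) /= addrCA.
  rewrite [f (letter_br x (l, v) :: _)](sml_swap hf [::] _ (_ + _)) /= scalerA.
  congr (_ *: _ + (_ *: _ + _ *: _)).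
  + rewrite !mulrDl !mul1r !sgD [l * k]mulrC.
    by case: (sg_or K (k * l)) => ->; ring.
  + by rewrite !mulrDl !mul1r !sgD; ring.
  + by ring.
Qed.

Lemma sum6AC (a b c d e h : Z) :
  a + b + (c + d + (e + h)) = a + (c + e) + (b + (d + h)).
Proof. by rewrite (addrACA c d e h) (addrACA a b). Qed.

Lemma sum_swapAC (a b c d e h : Z) :
  b + (a + (c + d) + (h + e)) = a + (b + (c + e) + (h + d)).
Proof.
rewrite -(addrA a (c + d)) -(addrA b (c + e)) (addrCA b a).
by rewrite (addrACA c d) (addrACA c e) [d + e]addrC.
Qed.

Lemma d_sum_sml f : symmultilinear f -> symmultilinear (d_sum f).
Proof.
move=> hf; split=> s1 s2.
- move=> k a u v; elim: s1 f hf => [|y s1 IH] f hf; last first.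
    rewrite !cat_cons !d_sum_cons (sml_lin hf (_ :: s1)) IH; last exact: sml_cons.
    rewrite (sml_lin (br_sum_sml y hf)) !scalerDr !scalerA [a * _]mulrC.
    exact: sum6AC.
  rewrite /= !d_sum_cons letter_d_lin // br_sum_linl //.
  rewrite (@eq_d_sum _ (fun w => a *: f ((k, u) :: w) + f ((k, v) :: w))).
    rewrite d_sum_lin !scalerDr !scalerA [a * _]mulrC.
    exact: sum6AC.
  by move=> w; apply: (sml_lin hf [::]).
- move=> k u; elim: s1 f hf => [|y s1 IH] f hf; last first.
    rewrite !cat_cons !d_sum_cons (sml_pr hf (_ :: s1)) IH; last exact: sml_cons.
    by rewrite (sml_pr (br_sum_sml y hf)).
  rewrite /= !d_sum_cons letter_d_pr // br_sum_prl //; congr (_ + (_ *: _ + _)).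
  by apply: eq_d_sum => w; apply: (sml_pr hf [::]).
- move=> k l u v; elim: s1 f hf => [|y s1 IH] f hf; last first.
    rewrite !cat_cons !d_sum_cons (sml_swap hf (_ :: s1)) IH; last exact: sml_cons.
    rewrite (sml_swap (br_sum_sml y hf)).
    by rewrite !scalerDr !scalerA [sg K (k * l) * _]mulrC.
  rewrite /= !d_sum_cons /= !br_sum_cons /= !scalerDr !scalerA.
  rewrite (@eq_d_sum _
    (fun w => sg K (k * l) *: f ((l, v) :: (k, u) :: w))); last first.
    by move=> w; apply: (sml_swap hf [::]).
  rewrite d_sumZ scalerA (letter_br_swap (k, u) (l, v)) //=.
  rewrite (sml_swap hf [::] _ (k + 1)) (sml_swap hf [::] _ (l + 1)) /= !scalerA.
  rewrite (sum_swapAC (sg K k *: _)); congr (_ *: _ + (_ *: _ + (_ *: _ + _ *: _) +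
    (_ *: _ + _ *: _))).
  + rewrite !mulrDl !mul1r !sgD [l * k]mulrC.
    by case: (sg_or K (k * l)) => ->; ring.
  + by rewrite !mulrDl !mul1r !sgD; ring.
  + by ring.
  + by rewrite !mulrDl !mul1r !sgD; ring.
  + rewrite !mulrDl !mul1r !sgD [l * k]mulrC.
    by case: (sg_or K (k * l)) => ->; ring.
Qed.

Lemma d_sum_nil f : d_sum f [::] = 0.
Proof. by rewrite /d_sum big_nil. Qed.

End Sum.

Definition cbar_d : {linear cbar -> cbar} :=
  symlift (d_sum_nil _) (d_sum_sml (word_sml g1)).

(* Projection of C_+(g) onto S^1(g[1]), with values in the unshifted g. *)
Definition corest_word (w : seq L) : g :=
  if w is [:: x] then gpr g1 x.1 x.2 else 0.

Lemma corest_word_sml : symmultilinear corest_word.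
Proof.
split=> [[|x [|y s1]] [|z s2] k a u v|[|x [|y s1]] [|z s2] k u
  |[|x [|y s1]] s2 k l u v] //=; rewrite ?scaler0 ?addr0 //.
- by rewrite linearP.
- by rewrite /shift_pr gprI eqxx.
Qed.

Definition corest : {linear cbar -> g} :=
  symlift (erefl : corest_word [::] = 0) corest_word_sml.

Lemma corestE w : corest (word w) = corest_word w.
Proof. exact: symliftE. Qed.

Lemma cbar_dE w : cbar_d (word w) = d_sum (@word K g1) w.
Proof. exact: symliftE. Qed.

End ChevalleyEilenberg.

Section LInfinityMorphisms.
Variable K : fieldType.
Implicit Types g h k : dgLie K.

(* Morphisms of dg coalgebras C_+(g) -> C_+(h). *)
Record linf g h := Linf {
  linf_map :> {linear cbar g -> cbar h};
  linf_deg : has_degree 0 linf_map;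
  linf_d : forall x, linf_map (cbar_d g x) = cbar_d h (linf_map x);
  linf_delta : forall x, symp_delta (shift 1 h) (linf_map x)
    = tmap linf_map linf_map (symp_delta (shift 1 g) x) }.

Lemma linear_eqP (U W : lmodType K) (f f' : {linear U -> W}) :
  f =1 f' -> f = f'.
Proof.
case: f f' => [f [[cf] [sf]]] [f' [[cf'] [sf']]] /= /funext e.
case: _ / e cf' sf' => cf' sf'.
by rewrite (Prop_irrelevance cf cf') (Prop_irrelevance sf sf').
Qed.

Lemma linf_eqP g h (p q : linf g h) : p =1 q -> p = q.
Proof.
case: p q => [p a b c] [q a' b' c'] /= /linear_eqP e.
by case: _ / e a' b' c' => *; congr Linf; apply: Prop_irrelevance.
Qed.

Program Definition linf_id g : linf g g := @Linf g g idfun _ _ _.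
Next Obligation. by move=> i x /=; rewrite addr0. Qed.
Next Obligation. by rewrite tmap_id. Qed.

Program Definition linf_comp g h k (q : linf h k) (p : linf g h) : linf g k :=
  @Linf g k (q \o p) _ _ _.
Next Obligation. by move=> i x /=; rewrite !linf_deg !addr0. Qed.
Next Obligation. by rewrite !linf_d. Qed.
Next Obligation. by rewrite tmap_comp /= !linf_delta. Qed.

(* The Taylor components of p, as an element of degree 1 of Hom(C_+(g), h). *)
Definition taylor g h (p : linf g h) : {linear cbar g -> h} :=
  corest h \o p.

(* The component F_1 on the degree n part of g. *)
Definition taylor1 g h (p : linf g h) (n : int) (x : g) : h :=
  taylor p (@word K (shift 1 g) [:: (n - 1, x)]).

(* F_1 : H^n(g) -> H^n(h) is injective and surjective for every n. *)
Definition quasi_iso g h (p : linf g h) : Prop := forall n : int,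
  (forall x : g, homog n x -> dgl_d g x = 0 ->
     (exists2 y : h, homog (n - 1) y & taylor1 p n x = dgl_d h y) ->
     exists2 z : g, homog (n - 1) z & x = dgl_d g z) /\
  (forall y : h, homog n y -> dgl_d h y = 0 ->
     exists x : g, [/\ homog n x, dgl_d g x = 0
       & exists2 z : h, homog (n - 1) z & y = taylor1 p n x + dgl_d h z]).

(* The dg Lie algebra Hom(C_+(g), h); in conv_d p t and conv_br q t1 t2 the
   degrees of t and of t2 are p and q. *)
Section Convolution.
Variables g h : dgLie K.
Implicit Types t : {linear cbar g -> h}.

(* (t1 (x) t2)(a (x) b) = (-1)^(|t2||a|) t1(a) (x) t2(b). *)
Definition koszul_sign (q : int) : {linear cbar g -> cbar g} :=
  @wscale K (shift 1 g) (fun n => sg K (q * n)).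

Definition conv_d (p : int) t : {linear cbar g -> h} :=
  (dgl_d h \o t) \- (sg K p \*: (t \o cbar_d g)).

Definition conv_br (q : int) t1 t2 : {linear cbar g -> h} :=
  tlift (dgl_br_linl (d := h)) (dgl_br_linr (d := h))
  \o tmap (t1 \o koszul_sign q) t2 \o symp_delta (shift 1 g).

(* p is a polynomial path in h with derivative dp. *)
Definition poly_deriv (p dp : K -> h) : Prop := exists c : seq h,
  (forall s, p s = \sum_(i < size c) s ^+ i *: c`_i) /\
  (forall s, dp s = \sum_(i < size c) (s ^+ i.-1 *+ i) *: c`_i).

(* The flow F(s) of F' = - d H + [H, F], F(0) = F. By pronilpotency with respect
   to the arity its values on each element of C_+(g) are polynomial in s. *)
Definition gauge_flow (H F : {linear cbar g -> h})
    (Ft : K -> {linear cbar g -> h}) : Prop :=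
  [/\ forall s, has_degree 1 (Ft s),
      Ft 0 = F
    & forall c : cbar g, poly_deriv (fun s => Ft s c)
        (fun s => - conv_d 0 H c + conv_br 1 H (Ft s) c)].

(* G = F_H. *)
Definition gauge_act (H F G : {linear cbar g -> h}) : Prop :=
  exists2 Ft, gauge_flow H F Ft & Ft 1 = G.

Definition homotopic (p q : linf g h) : Prop :=
  exists2 H : {linear cbar g -> h},
    has_degree 0 H & gauge_act H (taylor p) (taylor q).
End Convolution.
End LInfinityMorphisms.

Record category := Category {
  obj :> Type;
  mor : obj -> obj -> Type;
  idm : forall a, mor a a;
  compm : forall a b c, mor b c -> mor a b -> mor a c;
  compmA : forall a b c d (u : mor c d) (v : mor b c) (w : mor a b),
    compm u (compm v w) = compm (compm u v) w;
  comp1m : forall a b (u : mor a b), compm (idm b) u = u;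
  compm1 : forall a b (u : mor a b), compm u (idm a) = u }.

Definition invertible (X : category) (a b : X) (u : mor a b) : Prop :=
  exists v : mor b a, compm v u = idm a /\ compm u v = idm b.

Record functor (X Y : category) := Functor {
  fobj :> X -> Y;
  fmor : forall a b, mor a b -> mor (fobj a) (fobj b);
  fmor_id : forall a, fmor (idm a) = idm (fobj a);
  fmor_comp : forall a b c (u : mor b c) (v : mor a b),
    fmor (compm u v) = compm (fmor u) (fmor v) }.

Program Definition LieDg (K : fieldType) : category :=
  @Category (dgLie K) (@linf K) (@linf_id K) (@linf_comp K) _ _ _.
Next Obligation. exact: linf_eqP. Qed.
Next Obligation. exact: linf_eqP. Qed.
Next Obligation. exact: linf_eqP. Qed.

(* Main.v *)
From HB Require Import structures.
Require Import Defs.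
From mathcomp Require Import all_boot all_order all_algebra.
From mathcomp Require Import reals complex.
From mathcomp Require Import boolp functions ring.

(** Let h[t, dt] be the dg Lie algebra of polynomial differential forms on the line with
values in h. If F(t) is the gauge flow of H from p to q, then F(t) - dt H is a
Maurer-Cartan element with values in h[t, dt], that is, an L-infinity morphism from g to
h[t, dt] whose evaluations at t = 0 and t = 1 are p and q. Both evaluations
h[t, dt] -> h are quasi-isomorphisms split by the inclusion of the constants, so an
inverting functor sends both to the inverse of the image of that inclusion.

That the morphism of coalgebras given by cofreeness commutes with the differentials is
proved by induction on the length of words. The defect of commutation is a coderivation,
so on a word it is primitive once it vanishes on shorter words, hence determined by its
corestriction r. The flow equation says that corestrictions of the defect have no
dt-component. Since the differentials square to zero, the differential of r is again such
a corestriction, whence dr/dt = 0; and r vanishes at t = 0 because p commutes with the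
differentials. *)

Set Implicit Arguments.
Unset Strict Implicit.
Unset Printing Implicit Defensive.

Import Order.TTheory GRing.Theory Num.Theory.
Local Open Scope ring_scope.

#[local] Arguments gcar : simpl never.
#[local] Arguments cbar : simpl never.

(** * Unshuffles *)

(** Only the two ends of the flow are known to be L-infinity morphisms: that F(t) satisfies the
    Maurer-Cartan equation for the other t is not part of the definition of homotopy. The dt-part of
    the equation for F(t) - dt H is the flow equation; the dt-free part, which is the statement
    about F(t), is what dr/dt = 0 provides. A primitive element is determined by its corestriction
    because, in characteristic 0, the product after the reduced coproduct multiplies S^n by 2^n - 2,
    which vanishes only for n = 1. The cofree extension is a sum over partitions whose first block
    contains the first letter. Every unordered partition is then counted once, so no factorials
    occur and the bracket term of the Maurer-Cartan equation carries no factor 1/2. Coproduct,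
    differential and extension act on arbitrary functions of words as signed sums, which keeps
    quotients and tensor products out of the combinatorics. *)

Section MkLin.
Variables (K : fieldType) (U W : lmodType K) (f : U -> W).

Definition mklin_fun (_ : linear f) : U -> W := f.

HB.instance Definition _ (fl : linear f) :=
  GRing.isLinear.Build K U W *:%R (mklin_fun fl) fl.

Definition mklin (fl : linear f) : {linear U -> W} := mklin_fun fl.
End MkLin.

Lemma sg_double_add (K : fieldType) m n : sg K (n + n + m) = sg K m.
Proof. by rewrite !sgD sgsq mul1r. Qed.

Section UnshuffleCombinatorics.
Variables (K : fieldType) (V : gmod K) (Z : lmodType K).
Implicit Types (w a b : seq (letter V)).

(** The length constraint serves inductions on the length of words, the degree constraint the
    comparison of Koszul signs. *)
Lemma eq_unsh_sum_in (G G' : seq (letter V) -> seq (letter V) -> Z) w :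
  (forall a b, (size a + size b)%N = size w -> wdeg a + wdeg b = wdeg w ->
     G a b = G' a b) ->
  unsh_sum G w = unsh_sum G' w.
Proof.
elim: w G G' => [|x w IH] G G' h.
  by rewrite /unsh_sum !big_seq1 /= h //= /wdeg !big_nil addr0.
rewrite !unsh_sum_cons; congr (_ + _); apply: IH => a b sz dg.
  by apply: h; rewrite /= ?addSn ?sz // !wdeg_cons -dg addrA.
by congr (_ *: _); apply: h; rewrite /= ?addnS ?sz // !wdeg_cons -dg addrCA.
Qed.

Lemma linear_unsh_sum (Z' : lmodType K) (f : {linear Z -> Z'})
    (G : seq (letter V) -> seq (letter V) -> Z) w :
  f (unsh_sum G w) = unsh_sum (fun a b => f (G a b)) w.
Proof.
by rewrite /unsh_sum linear_sum; apply: eq_bigr => t _; rewrite linearZ.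
Qed.

Lemma unsh_sum0 w : unsh_sum (fun _ _ => 0 : Z) w = 0.
Proof. by rewrite /unsh_sum big1 // => t _; rewrite scaler0. Qed.

Lemma unsh_sum_nil (G : seq (letter V) -> seq (letter V) -> Z) :
  unsh_sum G [::] = G [::] [::].
Proof. by rewrite /unsh_sum big_seq1 scale1r. Qed.

(** Counit axiom of S(V): the only pair with empty left word is [([::], w)], and its sign is 1. *)
Lemma unsh_sum_nil_l (f : seq (letter V) -> Z) w :
  unsh_sum (fun a b => if a is [::] then f b else 0) w = f w.
Proof.
elim: w f => [|y v IH] f; first by rewrite unsh_sum_nil.
rewrite unsh_sum_cons unsh_sum0 add0r -[RHS](IH (fun v => f (y :: v))).
apply: eq_unsh_sum => -[|z a] b; last by rewrite /= scaler0.
by rewrite /wdeg big_nil mulr0 scale1r.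
Qed.

Lemma unsh_sum_nil_r (f : seq (letter V) -> Z) w :
  unsh_sum (fun a b => if b is [::] then f a else 0) w = f w.
Proof.
elim: w f => [|y v IH] f; first by rewrite unsh_sum_nil.
rewrite unsh_sum_cons IH -[RHS]addr0; congr (_ + _).
rewrite -[RHS](unsh_sum0 v).
by apply: eq_unsh_sum => a b; rewrite scaler0.
Qed.

(** Coassociativity of the coproduct of S(V): both sides run over the decompositions of [w] into
    three complementary subwords. *)
Lemma unsh_sum_assoc
    (T : seq (letter V) -> seq (letter V) -> seq (letter V) -> Z) w :
  unsh_sum (fun a b => unsh_sum (T a) b) w
  = unsh_sum (fun c e => unsh_sum (fun a b => T a b e) c) w.
Proof.
elim: w T => [|x w IH] T; first by rewrite !unsh_sum_nil.
rewrite !unsh_sum_cons.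
under [X in _ + X]eq_unsh_sum => a b do rewrite -unsh_sumZ unsh_sum_cons.
rewrite [X in _ = X + _](@eq_unsh_sum _ _ _ _ (fun c e =>
  unsh_sum (fun a b => T (x :: a) b e) c
  + unsh_sum (fun a b => sg K (x.1 * wdeg a) *: T a (x :: b) e) c)); last first.
  by move=> a b; rewrite unsh_sum_cons.
rewrite !unsh_sumD !IH -addrA; congr (_ + (_ + _)).
(* A letter [x] that falls in the third subword passes [a] and [b]; the two signs multiply to the
   sign of passing [c]. *)
rewrite [RHS](@eq_unsh_sum _ _ _ _ (fun c e => unsh_sum (fun a b =>
   sg K (x.1 * wdeg b) *: (sg K (x.1 * wdeg a) *: T a b (x :: e))) c)).
  by rewrite -IH.
move=> c e; rewrite -unsh_sumZ; apply: eq_unsh_sum_in => a b _ <-.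
by rewrite scalerA -sgD -mulrDr addrC.
Qed.

(** Graded cocommutativity of the coproduct of S(V). *)
Lemma unsh_sum_comm (T : seq (letter V) -> seq (letter V) -> Z) w :
  unsh_sum T w = unsh_sum (fun a b => sg K (wdeg a * wdeg b) *: T b a) w.
Proof.
elim: w T => [|x w IH] T.
  by rewrite !unsh_sum_nil /wdeg big_nil mul0r scale1r.
rewrite !unsh_sum_cons addrC IH; congr (_ + _).
  apply: eq_unsh_sum => a b.
  by rewrite wdeg_cons mulrDl sgD scalerA mulrC.
rewrite IH; apply: eq_unsh_sum => a b.
by rewrite wdeg_cons mulrDr sgD scalerA [wdeg a * x.1]mulrC mulrA sgsq mul1r.
Qed.

End UnshuffleCombinatorics.

(* Locked copies of the constructions on [symp V]: unification must not unfold the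
   underlying quotients. *)
HB.lock Definition cword (K : fieldType) (V : gmod K) (w : seq (letter V)) : symp V :=
  word w.
HB.lock Definition tns (K : fieldType) (U W : lmodType K) (u : U) (w : W) :
  tensor U W := tens u w.
HB.lock Definition sdelta (K : fieldType) (V : gmod K) :
  {linear symp V -> tensor (symp V) (symp V)} := symp_delta V.
HB.lock Definition swscale (K : fieldType) (V : gmod K) (c : int -> K) :
  {linear symp V -> symp V} := wscale V c.
HB.lock Definition tmapl (K : fieldType) (U U' W W' : lmodType K)
  (f : {linear U -> U'}) (g : {linear W -> W'}) :
  {linear tensor U W -> tensor U' W'} := tmap f g.

Section TensorLinearity.
Variables (K : fieldType) (U W : lmodType K).
Implicit Types (u : U) (w : W).

Lemma tns0l w : tns 0 w = 0 :> tensor U W.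
Proof. rewrite unlock; exact: (linear0 (tensl w)). Qed.

Lemma tns0r u : tns u 0 = 0 :> tensor U W.
Proof. rewrite unlock; exact: (linear0 (tensr u)). Qed.

Lemma tnsBl u u' w : tns (u - u') w = tns u w - tns u' w.
Proof. rewrite unlock; exact: (linearB (tensl w)). Qed.

Lemma tnsBr u w w' : tns u (w - w') = tns u w - tns u w'.
Proof. rewrite unlock; exact: (linearB (tensr u)). Qed.

Lemma tnsZl a u w : tns (a *: u) w = a *: tns u w.
Proof. rewrite unlock; exact: (linearZ_LR (tensl w)). Qed.

Lemma tns_linl w : linear (fun u : U => tns u w).
Proof. rewrite unlock; exact: tens_linl. Qed.

Lemma tns_linr u : linear (fun w : W => tns u w).
Proof. rewrite unlock; exact: tens_linr. Qed.

Lemma tns_ext (Z : lmodType K) (f f' : {linear tensor U W -> Z}) :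
  (forall u w, f (tns u w) = f' (tns u w)) -> f =1 f'.
Proof. rewrite unlock; exact: tensor_ext. Qed.
End TensorLinearity.

Lemma tmaplE (K : fieldType) (U U' W W' : lmodType K)
  (f : {linear U -> U'}) (g : {linear W -> W'}) u w :
  tmapl f g (tns u w) = tns (f u) (g w).
Proof. by rewrite !unlock tmapE. Qed.

(** * The product of the symmetric algebra and its composite with the coproduct *)

Section Primitive.
Variables (K : fieldType) (V : gmod K).
Local Notation S := (symp V).
Local Notation cword := (@cword K V).

Lemma cword_sml : symmultilinear cword.
Proof. rewrite unlock; exact: word_sml. Qed.

Lemma cword_nil : cword [::] = 0.
Proof. rewrite unlock; exact: word_nil. Qed.

Lemma sdelta_cword w :
  sdelta V (cword w) = unsh_sum (fun a b => tns (cword a) (cword b)) w.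
Proof. rewrite !unlock; exact: symp_deltaE. Qed.

Lemma swscale_cword (c : int -> K) w : swscale V c (cword w) = c (wdeg w) *: cword w.
Proof. rewrite !unlock; exact: wscaleE. Qed.

Lemma symlift_cword (Z : lmodType K) (f : seq (letter V) -> Z) f0 fsml w :
  (@symlift K V Z f f0 fsml : {linear S -> Z}) (cword w) = f w.
Proof. rewrite unlock; exact: symliftE. Qed.

Lemma cword_ext (Z : lmodType K) (f f' : {linear S -> Z}) :
  (forall w, f (cword w) = f' (cword w)) -> f =1 f'.
Proof. rewrite unlock; exact: symp_ext. Qed.

Lemma sml_swap_head (Z : lmodType K) (f : seq (letter V) -> Z)
    (hf : symmultilinear f) x y w :
  f (x :: y :: w) = sg K (x.1 * y.1) *: f (y :: x :: w).
Proof. by case: x y => [k u] [l v]; apply: (sml_swap hf [::]). Qed.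

Lemma sml_cat_l (Z : lmodType K) (f : seq (letter V) -> Z) s :
  symmultilinear f -> symmultilinear (fun w => f (s ++ w)).
Proof. by elim: s f => [|x s IH] f // /(sml_cons x) /IH. Qed.

Lemma sml_cat_r (Z : lmodType K) (f : seq (letter V) -> Z) s :
  symmultilinear f -> symmultilinear (fun w => f (w ++ s)).
Proof.
case=> fl fp fs; split=> *; rewrite -!catA /=; [exact: fl|exact: fp|exact: fs].
Qed.

Lemma sml_nonempty (Z : lmodType K) (f : seq (letter V) -> Z) :
  symmultilinear f -> symmultilinear (fun w => if w is [::] then 0 else f w).
Proof.
by case=> fl fp fs; split=> [[|x s1] s2 k a u v|[|x s1] s2 k u
  |[|x s1] s2 k l u v] //=; first [exact: (fl [::])|exact: (fl (x :: s1))
  |exact: (fp [::])|exact: (fp (x :: s1))|exact: (fs [::])|exact: (fs (x :: s1))].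
Qed.

(** The product of S(V) on the part without unit. The value 0 at an empty word is forced, since
    [cword [::]] is 0. *)
Definition wcat (a b : seq (letter V)) : S :=
  if a is [::] then 0 else if b is [::] then 0 else cword (a ++ b).

Lemma wcat0r a : wcat a [::] = 0.
Proof. by case: a. Qed.

Lemma wcat_sml_l b : symmultilinear (wcat^~ b).
Proof.
case: b => [|y b].
  by split=> *; rewrite !wcat0r ?scaler0 ?addr0.
exact: sml_nonempty (sml_cat_r (y :: b) (cword_sml)).
Qed.

Lemma wcat_sml_r a : symmultilinear (wcat a).
Proof.
case: a => [|x a]; first by split=> *; rewrite /wcat ?scaler0 ?addr0.
exact: sml_nonempty (sml_cat_l (x :: a) (cword_sml)).
Qed.

Definition smulr_word (a : seq (letter V)) : {linear S -> S} :=
  symlift (wcat0r a) (wcat_sml_r a).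

Lemma smulr_wordE a b : smulr_word a (cword b) = wcat a b.
Proof. exact: symlift_cword. Qed.

Lemma smulr_word_sml v : symmultilinear (smulr_word^~ v).
Proof.
split=> [s1 s2 k a u u'|s1 s2 k u|s1 s2 k l u u'].
- apply: (cword_ext (f' := a \*: smulr_word _ \+ smulr_word _)) => w /=.
  by rewrite !smulr_wordE; apply: (sml_lin (wcat_sml_l w)).
- apply: cword_ext => w.
  by rewrite !smulr_wordE; apply: (sml_pr (wcat_sml_l w)).
- apply: (cword_ext (f' := _ \*: smulr_word _)) => w /=.
  by rewrite !smulr_wordE; apply: (sml_swap (wcat_sml_l w)).
Qed.

Lemma smulr_word_nil v : smulr_word [::] v = 0.
Proof. by apply: (cword_ext (f' := \0)) => w; rewrite smulr_wordE. Qed.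

Definition smul (u v : S) : S :=
  (symlift (smulr_word_nil v) (smulr_word_sml v) : {linear S -> S}) u.

Lemma smul_linl v : linear (smul^~ v).
Proof. by move=> a u u'; rewrite /smul linearP. Qed.

Lemma smul_linr u : linear (smul u).
Proof.
move=> a v v'; rewrite /smul; apply: (cword_ext (f' := a \*: (symlift _ _ : {linear S -> S}) \+ (symlift _ _ : {linear S -> S}))).
by move=> w /=; rewrite !symlift_cword linearP.
Qed.

Lemma arity_sml (c : nat -> K) : symmultilinear (fun w => c (size w) *: cword w).
Proof.
case: cword_sml => fl fp fs; split=> *; rewrite !size_cat /=.
- by rewrite fl scalerDr !scalerA mulrC.
- by rewrite fp.
- by rewrite fs !scalerA mulrC.
Qed.

Lemma arity_nil (c : nat -> K) : c 0%N *: cword [::] = 0.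
Proof. by rewrite cword_nil scaler0. Qed.

End Primitive.

HB.lock Definition smult (K : fieldType) (V : gmod K) :
  {linear tensor (symp V) (symp V) -> symp V} :=
  tlift (@smul_linl K V) (@smul_linr K V).

HB.lock Definition arity_scale (K : fieldType) (V : gmod K) (c : nat -> K) :
  {linear symp V -> symp V} := symlift (arity_nil V c) (arity_sml V c).

Section Multiplication.
Variables (K : fieldType) (V : gmod K).
Local Notation S := (symp V).
Local Notation cword := (@cword K V).
Local Notation smult := (@smult K V).

Lemma smult_tens a b : smult (tns (cword a) (cword b)) = wcat a b.
Proof. by rewrite !(smult.unlock, tns.unlock) tliftE /smul symlift_cword smulr_wordE. Qed.

Lemma arity_scaleE c w : arity_scale V c (cword w) = c (size w) *: cword w.
Proof. by rewrite unlock; exact: symlift_cword. Qed.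

(** Each of the [2 ^+ size w] unshuffles contributes the same term: sorting [a ++ b] back into [w]
    costs exactly the Koszul sign of the unshuffle. *)
Lemma unsh_sum_word w :
  unsh_sum (fun a b => cword (a ++ b)) w = 2 ^+ size w *: cword w.
Proof.
(* The induction passes from [f] to [fun w => f (x :: w)], hence the generality. *)
suff h (Z : lmodType K) (f : seq (letter V) -> Z) : symmultilinear f ->
    unsh_sum (fun a b => f (a ++ b)) w = 2 ^+ size w *: f w.
  exact/h/cword_sml.
elim: w f => [|x w IH] f hf; first by rewrite unsh_sum_nil expr0 scale1r.
rewrite unsh_sum_cons /= exprS -scalerA scaler_nat mulr2n; congr (_ + _).
  by rewrite (IH (fun w => f (x :: w))) //; apply: sml_cons.
rewrite -(IH (fun w => f (x :: w))); last exact: sml_cons.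
apply: eq_unsh_sum => a b.
elim: a f hf => [|y a IHa] f hf /=; first by rewrite /wdeg big_nil mulr0 scale1r.
rewrite wdeg_cons mulrDr sgD -scalerA (IHa (fun w => f (y :: w))); last exact: sml_cons.
by rewrite -(sml_swap_head hf).
Qed.

(** The 2 subtracted from [2 ^+ n] accounts for the two unshuffles with an empty side, which the
    reduced coproduct omits. *)
Lemma smult_delta x : smult (sdelta V x) = arity_scale V (fun n => 2 ^+ n - 2) x.
Proof.
move: x; apply: (@cword_ext _ _ _ (smult \o sdelta V)) => w /=.
rewrite sdelta_cword arity_scaleE linear_unsh_sum.
under eq_unsh_sum do rewrite smult_tens.
rewrite scalerBl -unsh_sum_word scaler_nat mulr2n.
rewrite -{1}(unsh_sum_nil_l cword w) -(unsh_sum_nil_r cword w) -unsh_sumD.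
apply/eqP; rewrite eq_sym subr_eq -unsh_sumD; apply/eqP.
apply: eq_unsh_sum => -[|x a] [|y b]; rewrite /= ?cword_nil ?cats0 ?add0r ?addr0 //.
Qed.
End Multiplication.

HB.lock Definition ced (K : fieldType) (g : dgLie K) :
  {linear cbar g -> cbar g} := cbar_d g.
HB.lock Definition ceproj (K : fieldType) (g : dgLie K) :
  {linear cbar g -> g} := corest g.

(** * The Chevalley-Eilenberg coalgebra *)

Section Coderivation.
Variables (K : fieldType) (g : dgLie K).
Local Notation L := (letter (shift 1 g)).

Section Sums.
Variable Z : lmodType K.
Implicit Types (f : seq L -> Z) (G : seq L -> seq L -> Z).

Lemma br_sumD f f' x w :
  br_sum (fun w => f w + f' w) x w = br_sum f x w + br_sum f' x w.
Proof.
rewrite -[X in X + _]scale1r -br_sum_lin; apply: eq_br_sum => v.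
by rewrite scale1r.
Qed.

Lemma d_sumD f f' w : d_sum (fun w => f w + f' w) w = d_sum f w + d_sum f' w.
Proof.
rewrite -[X in X + _]scale1r -d_sum_lin; apply: eq_d_sum => v.
by rewrite scale1r.
Qed.

Lemma br_sum_nil f x : br_sum f x [::] = 0.
Proof. by rewrite /br_sum big_nil. Qed.

Lemma br_sum_wdeg f (c : int -> K) x w :
  br_sum (fun w => c (wdeg w) *: f w) x w
  = c (wdeg w + (x.1 + 1)) *: br_sum f x w.
Proof.
elim: w f c => [|y w IH] f c; first by rewrite !br_sum_nil scaler0.
rewrite !br_sum_cons scalerDr !wdeg_cons /=; congr (_ *: _ + _).
  by congr c; ring.
rewrite (@eq_br_sum _ _ _ _ (fun w => c (y.1 + wdeg w) *: f (y :: w))).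
  rewrite (IH (fun w => f (y :: w)) (fun n => c (y.1 + n))) !scalerA mulrC.
  by rewrite addrA.
by move=> v; rewrite wdeg_cons.
Qed.

Lemma d_sum_wdeg f (c : int -> K) w :
  d_sum (fun w => c (wdeg w) *: f w) w = c (wdeg w + 1) *: d_sum f w.
Proof.
elim: w f c => [|y w IH] f c; first by rewrite !d_sum_nil scaler0.
rewrite !d_sum_cons !scalerDr !wdeg_cons /=; congr (_ *: _ + (_ + _)).
- by congr c; ring.
- rewrite (@eq_d_sum _ _ _ _ (fun w => c (y.1 + wdeg w) *: f (y :: w))).
    rewrite (IH (fun w => f (y :: w)) (fun n => c (y.1 + n))) !scalerA mulrC.
    by rewrite addrA.
  by move=> v; rewrite wdeg_cons.
- by rewrite br_sum_wdeg; congr (c _ *: _); ring.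
Qed.

(** Bracketing with [x] is a coderivation: the letter that absorbs [x] lies in [a] or in [b], and in
    the second case the operator, of degree [x.1 + 1], passes [a]. *)
Lemma br_sum_unsh G x w : br_sum (unsh_sum G) x w =
  unsh_sum (fun a b => br_sum (G^~ b) x a
    + sg K ((x.1 + 1) * wdeg a) *: br_sum (G a) x b) w.
Proof.
elim: w G => [|y w IH] G; first by rewrite unsh_sum_nil !br_sum_nil scaler0 addr0.
rewrite br_sum_cons !unsh_sum_cons.
rewrite [X in _ + _ *: X](eq_br_sum _ _ (unsh_sum_cons G y)) br_sumD !IH.
rewrite scalerDr -!unsh_sumZ addrACA.
congr (_ + _); rewrite -unsh_sumD; apply: eq_unsh_sum => a b; rewrite !br_sum_cons /=.
  by rewrite wdeg_cons mulrDr sgD -!scalerA scalerDr addrA.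
rewrite br_sumZ (br_sum_wdeg _ (fun n => sg K (y.1 * n))).
rewrite !scalerDr !scalerA -!sgD addrCA; congr (_ *: _ + (_ *: _ + _ *: _)).
- by rewrite -[RHS](sg_double_add _ _ ((x.1 + 1) * y.1)); congr (sg K _); ring.
- by congr (sg K _); ring.
- by congr (sg K _); ring.
Qed.

(** The differential is a coderivation of S(V). In the induction, the part of [{x, w}] acting on [a]
    goes with the summand that has [x] on the left, the part acting on [b] with the one that has [x]
    on the right. *)
Lemma d_sum_unsh G w : d_sum (unsh_sum G) w =
  unsh_sum (fun a b => d_sum (G^~ b) a + sg K (wdeg a) *: d_sum (G a) b) w.
Proof.
elim: w G => [|x w IH] G; first by rewrite unsh_sum_nil !d_sum_nil scaler0 addr0.
rewrite d_sum_cons !unsh_sum_cons br_sum_unsh.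
rewrite [X in _ + (_ *: X + _)](eq_d_sum _ (unsh_sum_cons G x)) d_sumD !IH.
rewrite scalerDr -!unsh_sumZ unsh_sumD.
rewrite sum6AC.
congr (_ + _); rewrite -!unsh_sumD; apply: eq_unsh_sum => a b; rewrite !d_sum_cons /=.
  rewrite wdeg_cons sgD !scalerDr -!scalerA -!addrA; congr (_ + (_ + _)).
  by rewrite addrC.
rewrite d_sumZ (d_sum_wdeg _ (fun n => sg K (x.1 * n))).
rewrite !scalerDr !scalerA -!sgD.
rewrite -[X in _ + X]addrA [LHS]addrCA.
congr (_ *: _ + (_ *: _ + (_ *: _ + _ *: _))).
- by rewrite -[RHS](sg_double_add _ _ x.1); congr (sg K _); ring.
- by congr (sg K _); ring.
- by congr (sg K _); ring.
- by congr (sg K _); ring.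
Qed.
End Sums.

Lemma linear_d_sum (Z Z' : lmodType K) (f : {linear Z -> Z'}) (F : seq L -> Z) w :
  f (d_sum F w) = d_sum (fun w => f (F w)) w.
Proof.
by rewrite /d_sum linear_sum; apply: eq_bigr => t _; rewrite linearZ.
Qed.

Lemma ced_cword w : ced g (cword w) = d_sum (@cword K (shift 1 g)) w.
Proof. rewrite !unlock; exact: cbar_dE. Qed.

Lemma ceproj_cword w : ceproj g (cword w) = corest_word w.
Proof. rewrite !unlock; exact: corestE. Qed.

(** [swscale (sg K)] is the sign of moving the odd map [ced] past the left tensor factor. *)
Lemma sdelta_ced (x : cbar g) : sdelta (shift 1 g) (ced g x)
  = tmapl (ced g) idfun (sdelta (shift 1 g) x)
    + tmapl (swscale (shift 1 g) (sg K)) (ced g) (sdelta (shift 1 g) x).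
Proof.
move: x; apply: (@cword_ext _ _ _ (sdelta _ \o ced g)
  ((tmapl _ _ \o sdelta _) \+ (tmapl _ _ \o sdelta _))) => w /=.
rewrite ced_cword (linear_d_sum (sdelta (shift 1 g))).
rewrite (eq_d_sum _ (@sdelta_cword K (shift 1 g))) d_sum_unsh sdelta_cword.
rewrite !linear_unsh_sum -unsh_sumD; apply: eq_unsh_sum => a b.
rewrite tmaplE.
rewrite tmaplE.
rewrite !ced_cword.
rewrite swscale_cword.
congr (_ + _).
  symmetry; exact: (linear_d_sum (mklin (@tns_linl _ _ _ (cword b)))).
rewrite -(linear_d_sum (mklin (@tns_linr _ _ _ (cword a)))).
by rewrite tnsZl.
Qed.
End Coderivation.

(** * Coderivations and coalgebra maps are determined by their corestrictions *)

Section Rigidity.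
Variables (K : fieldType) (char0 : [pchar K] =i pred0).
Implicit Types g h : dgLie K.

Definition word1 g (k : int) : {linear g -> cbar g} :=
  mklin (sml_lin (@cword_sml K (shift 1 g)) [::] [::] k).

Lemma gpr_cword g k w :
  gpr (cbar g) k (cword w) = (wdeg w == k)%:R *: cword w.
Proof. by rewrite -(swscale_cword (fun m => (m == k)%:R)) swscale.unlock. Qed.

(** By [smult_delta], a primitive element is killed by the scaling of each arity [n] by
    [2 ^+ n - 2], so in characteristic 0 only arity 1 survives. *)
Lemma gpr_primitive g (x : cbar g) k :
  sdelta (shift 1 g) x = 0 -> gpr (cbar g) k x = word1 g k (ceproj g x).
Proof.
move=> dx; have /= := smult_delta x; rewrite dx linear0 => /esym ax.
have {1}-> : x = arity_scale (shift 1 g) (fun n => (n == 1%N)%:R) x.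
  (* The factor [(2 ^+ n - 2)^-1] recovers all arities other than 1 from the zero element
     [smult (sdelta x)]. *)
  rewrite -[RHS]addr0 -(linear0 (arity_scale (shift 1 g)
    (fun n => if n == 1%N then 0 else (2 ^+ n - 2)^-1))) -ax.
  move: x {dx ax}; apply: (@cword_ext _ _ _ idfun (arity_scale _ _ \+
    (arity_scale _ _ \o arity_scale _ _))) => w /=.
  rewrite !arity_scaleE linearZ_LR arity_scaleE scalerA -scalerDl.
  case: eqP => [_|n1]; first by rewrite mulr0 addr0 scale1r.
  rewrite add0r mulfV ?scale1r // -natrX.
  case: (size w) n1 => [|[|n]] // _.
    by rewrite expn0 opprD addrA subrr sub0r oppr_eq0 oner_eq0.
  rewrite -natrB ?(leq_exp2l 1) // ((pcharf0P K).1 char0) subn_eq0 -ltnNge.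
  by rewrite (ltn_exp2l 1).
move: x {dx ax}; apply: (@cword_ext _ _ _ (gpr (cbar g) k \o arity_scale _ _)
  (word1 g k \o ceproj g)) => w /=.
rewrite arity_scaleE linearZ_LR /= ceproj_cword.
case: w => [|[l v] [|y w]] /=; rewrite ?scale0r ?linear0 // scale1r.
rewrite gpr_cword /wdeg big_seq1 /= /word1 /mklin /mklin_fun /=.
have -> : @cword K (shift 1 g) [:: (k, shift_pr 1 g l v)]
    = @cword K (shift 1 g) [:: (k, gpr g (1 + k) (gpr g (1 + l) v))].
  by rewrite [LHS](sml_pr (@cword_sml K (shift 1 g)) [::] [::]).
rewrite gprI (inj_eq (addrI 1)) eq_sym; case: eqP => [->|_].
  by rewrite scale1r [LHS](sml_pr (@cword_sml K (shift 1 g)) [::] [::]).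
by rewrite scale0r [RHS](sml0 [::] _ _ (@cword_sml K (shift 1 g))).
Qed.

Lemma primitive_eq0 g (x : cbar g) :
  sdelta (shift 1 g) x = 0 -> ceproj g x = 0 -> x = 0.
Proof.
move=> dx cx; have [s _ ->] := @gpr_sum K (cbar g) x.
by apply: big1 => k _; rewrite [LHS](gpr_primitive k dx) cx linear0.
Qed.

Section Rigid.
Variables (g h : dgLie K) (E P Q : {linear cbar g -> cbar h}).
Hypothesis E_delta : forall x, sdelta (shift 1 h) (E x)
  = tmapl E P (sdelta (shift 1 g) x) + tmapl Q E (sdelta (shift 1 g) x).

(** The reduced coproduct of [w] involves only words shorter than [w]: a pair with an empty side
    contributes 0, and otherwise both sides are shorter. *)
Lemma delta_eq0 n w : (forall v, (size v < n)%N -> E (cword v) = 0) ->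
  (size w <= n)%N -> sdelta (shift 1 h) (E (cword w)) = 0.
Proof.
move=> E0 sw; rewrite E_delta sdelta_cword !linear_unsh_sum -unsh_sumD.
rewrite -[RHS](@unsh_sum0 _ _ _ w); apply: eq_unsh_sum_in => a b ab _.
rewrite 2!tmaplE.
have -> : tns (E (cword a)) (P (cword b)) = 0.
  case: b ab => [|y b] ab; first by rewrite cword_nil linear0 tns0r.
  rewrite E0 ?tns0l //; move: sw; rewrite -ab /= addnS.
  by apply: leq_trans; rewrite ltnS leq_addr.
rewrite add0r.
case: a ab => [|y a] ab; first by rewrite cword_nil linear0 tns0l.
rewrite E0 ?tns0r //; move: sw; rewrite -ab /= addSn.
by apply: leq_trans; rewrite ltnS leq_addl.
Qed.

(** The two maps [P] and [Q] make this apply both to the difference of two coalgebra maps and to the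
    square of the differential. *)
Lemma rigid_eq0 : (forall x, ceproj h (E x) = 0) -> E =1 \0.
Proof.
move=> cE; apply: cword_ext => w /=.
have [n] := ubnP (size w); elim: n w => // n IH w sw.
by apply: primitive_eq0 => //; apply: (@delta_eq0 n) => // v; apply: IH.
Qed.
End Rigid.

(** The difference [P - Q] is a coderivation along [P] and [Q], since P (x) P - Q (x) Q = (P - Q)
    (x) P + Q (x) (P - Q). *)
Lemma coalgebra_map_unique g h (P Q : {linear cbar g -> cbar h}) :
  (forall x, sdelta (shift 1 h) (P x) = tmapl P P (sdelta (shift 1 g) x)) ->
  (forall x, sdelta (shift 1 h) (Q x) = tmapl Q Q (sdelta (shift 1 g) x)) ->
  (forall x, ceproj h (P x) = ceproj h (Q x)) -> P =1 Q.
Proof.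
move=> dP dQ cPQ x; apply/eqP; rewrite -subr_eq0; apply/eqP.
apply: (@rigid_eq0 _ _ (P \- Q) P Q) => y; last first.
  by rewrite /= linearB cPQ subrr.
rewrite /= linearB dP dQ; move: (sdelta _ y).
apply: (@tns_ext _ _ _ _ (tmapl P P \- tmapl Q Q)
  (tmapl (P \- Q) P \+ tmapl Q (P \- Q))) => u v /=.
rewrite 4!tmaplE /= tnsBl tnsBr.
by rewrite addrA subrK.
Qed.

End Rigidity.

Lemma scale4_eq0 (K : fieldType) (Z : lmodType K) (u v : Z) a b c e :
  a + c = 0 -> b + e = 0 -> a *: u + (b *: v + (c *: u + e *: v)) = 0.
Proof.
move=> ac be; rewrite (addrCA (b *: v)) (addrA (a *: u)) -!scalerDl ac be.
by rewrite !scale0r addr0.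
Qed.

(** * The Chevalley-Eilenberg differential squares to zero *)

Section CobarDifferential.
Variables (K : fieldType) (g : dgLie K).
Local Notation L := (letter (shift 1 g)).
Local Notation lpr x := (gpr g (1 + x.1) x.2).

(** The corestriction of the differential, as [ceproj_ced] shows. It stops at two letters because
    the differential shortens a word by at most one. *)
Definition ce_word (w : seq L) : g :=
  match w with
  | [:: x] => - dgl_d g (lpr x)
  | [:: x; y] => sg K (x.1 + 1) *: dgl_br (lpr x) (lpr y)
  | _ => 0
  end.

Lemma br_sum_eq0 (Z : lmodType K) (f : seq L -> Z) x w :
  (forall v, size v = size w -> f v = 0) -> br_sum f x w = 0.
Proof.
elim: w f => [|y w IH] f f0; first exact: br_sum_nil.
rewrite br_sum_cons f0 // IH ?scaler0 ?addr0 // => v sv.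
by apply: f0; rewrite /= sv.
Qed.

Lemma d_sum_eq0 (Z : lmodType K) (f : seq L -> Z) w :
  (forall v, (size w <= (size v).+1)%N -> f v = 0) -> d_sum f w = 0.
Proof.
elim: w f => [|y w IH] f f0; first exact: d_sum_nil.
rewrite d_sum_cons f0 ?leqnSn // IH; last by move=> v sv; apply: f0.
by rewrite br_sum_eq0 ?scaler0 ?addr0 // => v sv; apply: f0; rewrite /= sv.
Qed.

Lemma gprK k v : gpr g k (gpr g k v) = gpr g k v.
Proof. by rewrite gprI eqxx. Qed.

Lemma gpr_homog k v : homog k (gpr g k v).
Proof. exact: gprK. Qed.

Lemma lpr_br x y :
  lpr (letter_br x y) = sg K (x.1 + 1) *: dgl_br (lpr x) (lpr y).
Proof.
rewrite /letter_br /= linearZ_LR; congr (_ *: _).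
have -> : 1 + (x.1 + y.1 + 1) = (1 + x.1) + (1 + y.1) by ring.
by apply: dgl_br_deg; apply: gpr_homog.
Qed.

Lemma lpr_d x : lpr (letter_d x) = - dgl_d g (lpr x).
Proof.
rewrite /letter_d /= linearN dgl_d_deg.
by congr (- gpr g _ _); ring.
Qed.

Lemma d_sum_corest (w : seq L) : d_sum (@corest_word K g) w = ce_word w.
Proof.
case: w => [|x [|y [|z w]]] /=; first exact: d_sum_nil.
- rewrite d_sum_cons d_sum_nil br_sum_nil scaler0 !addr0 -lpr_d.
  by rewrite /= /shift_pr.
- rewrite !d_sum_cons !br_sum_cons d_sum_nil !br_sum_nil /= !(scaler0, addr0) add0r.
  by rewrite add0r; exact: lpr_br.
- by apply: d_sum_eq0; case=> [|? [|? v]].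
Qed.

Lemma ceproj_ced w : ceproj g (ced g (cword w)) = ce_word w.
Proof.
rewrite ced_cword linear_d_sum -d_sum_corest.
by apply: eq_d_sum => v; rewrite ceproj_cword.
Qed.

(** One, two and three letters give in turn [d] squared, the Leibniz rule and the Jacobi identity.
    On longer words the differential leaves at least three letters, where [ce_word] vanishes. *)
Lemma d_sum_ce_word w : d_sum ce_word w = 0.
Proof.
have brl a x y : dgl_br (a *: x) y = a *: dgl_br (d := g) x y.
  exact: (linearZ_LR (mklin (dgl_br_linl y))).
have brr a x y : dgl_br x (a *: y) = a *: dgl_br (d := g) x y.
  exact: (linearZ_LR (mklin (dgl_br_linr x))).
case: w => [|x [|y [|z [|t w]]]].
- exact: d_sum_nil.
- rewrite d_sum_cons d_sum_nil br_sum_nil scaler0 !addr0.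
  by rewrite [LHS]/ce_word lpr_d linearN opprK dgl_dd.
- rewrite !d_sum_cons !br_sum_cons d_sum_nil !br_sum_nil !scaler0 !addr0.
  rewrite /ce_word !lpr_d lpr_br !scalerA linearZ_LR -!scaleN1r brl brr.
  rewrite (dgl_leibniz _ (gpr_homog (1 + x.1) x.2)) !scalerDr !scalerA.
  apply: scale4_eq0; rewrite /= !sgD sg1; first by ring.
  by case: (sg_or K x.1) => ->; ring.
- rewrite !d_sum_cons !br_sum_cons d_sum_nil !br_sum_nil /=.
  rewrite !(scaler0, addr0, add0r).
  rewrite !lpr_br !(brl, brr, scalerA).
  rewrite (dgl_jacobi _ (gpr_homog (1 + x.1) x.2) (gpr_homog (1 + y.1) y.2)).
  rewrite scalerDr scalerA -addrA.
  apply: scale4_eq0; rewrite /= ?mulrDr ?mulrDl ?mulrDr ?mul1r ?mulr1 !sgD sg1.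
    by case: (sg_or K x.1) => ->; case: (sg_or K y.1) => ->; ring.
  by case: (sg_or K x.1) => ->; case: (sg_or K y.1) => ->; ring.
- by apply: d_sum_eq0; case=> [|? [|? [|? v]]].
Qed.


Local Notation sigma := (swscale (shift 1 g) (sg K)).

Lemma sigmaK x : sigma (sigma x) = x.
Proof.
move: x; apply: (@cword_ext _ _ _ (sigma \o sigma) idfun) => w /=.
by rewrite swscale_cword linearZ_LR swscale_cword scalerA sgsq scale1r.
Qed.

Lemma sigma_ced x : sigma (ced g x) = - ced g (sigma x).
Proof.
move: x; apply: (@cword_ext _ _ _ (sigma \o ced g) (- (ced g \o sigma))) => w /=.
rewrite swscale_cword linearZ_LR ced_cword linear_d_sum.
rewrite (eq_d_sum _ (swscale_cword (sg K))) d_sum_wdeg sgD sg1.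
by rewrite mulrN1 scaleNr.
Qed.

(** The square of [ced] is a coderivation along the identity, the cross terms cancelling by
    [sigma_ced]; it is therefore determined by its corestriction, which is 0 by [d_sum_ce_word]. *)
Lemma ced_ced (char0 : [pchar K] =i pred0) x : ced g (ced g x) = 0.
Proof.
apply: (@rigid_eq0 _ char0 _ _ (ced g \o ced g) idfun idfun) => y /=; last first.
  move: y; apply: (@cword_ext _ _ _ (ceproj g \o (ced g \o ced g)) \0) => w /=.
  rewrite ced_cword linear_d_sum linear_d_sum -[RHS](d_sum_ce_word w).
  by apply: eq_d_sum => v; rewrite ceproj_ced.
rewrite !sdelta_ced !linearD /= -!addrA; move: (sdelta _ y) => {}y.
pose D1 := tmapl (ced g) (idfun : {linear cbar g -> cbar g}).
pose D2 := tmapl sigma (ced g).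
move: y; apply: (@tns_ext _ _ _ _ ((D1 \o D1) \+ ((D1 \o D2) \+
  ((D2 \o D1) \+ (D2 \o D2)))) (tmapl _ _ \+ tmapl _ _)) => u v /=.
rewrite /D1 /D2 !tmaplE /= sigmaK sigma_ced.
rewrite -[- ced g _]scaleN1r tnsZl scaleN1r; congr (_ + _).
by rewrite addrA subrr add0r.
Qed.

End CobarDifferential.

(** * Morphisms into the cofree coalgebra *)

Section Cofree.
Variables (K : fieldType) (V W : gmod K) (f : seq (letter V) -> W).
Hypothesis f_sml : symmultilinear f.
Local Notation LV := (letter V).
Local Notation LW := (letter W).

Definition fletter (w : seq LV) : LW := (wdeg w, f w).

Section Values.
Variable Z : lmodType K.
Implicit Types (G : seq LW -> Z) (w : seq LV).

(* The signed sum over the partitions of [w] into at most [n] blocks of the values of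
   [G] at the sequences of images of the blocks; the first block is [x :: a]. *)
Fixpoint partition_sum (n : nat) G w {struct n} : Z :=
  match w with
  | [::] => G [::]
  | x :: w' =>
    match n with
    | 0 => 0
    | n'.+1 =>
      unsh_sum (fun a b => partition_sum n' (fun u => G (fletter (x :: a) :: u)) b) w'
    end
  end.

(** Dual form of the cofree extension of [f]: at [G = cword] it is the image of [w], and other [G]
    compute coproducts and corestrictions of that image. *)
Definition pullback G w : Z := partition_sum (size w) G w.

Lemma eq_partition_sum n G G' w : G =1 G' ->
  partition_sum n G w = partition_sum n G' w.
Proof.
elim: n G G' w => [|n IH] G G' [|x w] h //=.
by apply: eq_unsh_sum => a b; apply: IH => u.
Qed.

Lemma partition_sum_lin n G G' c w :
  partition_sum n (fun u => c *: G u + G' u) w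
  = c *: partition_sum n G w + partition_sum n G' w.
Proof.
elim: n G G' w => [|n IH] G G' [|x w] //=; first by rewrite scaler0 addr0.
by rewrite -unsh_sum_lin; apply: eq_unsh_sum => a b; rewrite IH.
Qed.

Lemma partition_sum0 n w : partition_sum n (fun _ => 0) w = 0.
Proof.
elim: n w => [|n IH] [|x w] //=; rewrite -[RHS](unsh_sum0 Z w).
by apply: eq_unsh_sum => a b.
Qed.

Lemma partition_sumZ n G c w :
  partition_sum n (fun u => c *: G u) w = c *: partition_sum n G w.
Proof.
rewrite -[RHS]addr0 -(partition_sum0 n w) -partition_sum_lin.
by apply: eq_partition_sum => u; rewrite addr0.
Qed.

(** Blocks are nonempty, so the length of [w] bounds their number and any larger bound gives the
    same sum. *)
Lemma partition_sum_stable n m G w : (size w <= n)%N -> (size w <= m)%N ->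
  partition_sum n G w = partition_sum m G w.
Proof.
elim: n m G w => [|n IH] [|m] G [|x w] //= wn wm.
apply: eq_unsh_sum_in => a b ab _.
have bw : (size b <= size w)%N by rewrite -ab leq_addl.
by apply: IH; apply: leq_trans bw _.
Qed.

Lemma fletter_sml G u : symmultilinear G ->
  symmultilinear (fun w => G (fletter w :: u)).
Proof.
case: f_sml => fl fp fs hG; split=> *; rewrite /fletter !(wdeg_cat, wdeg_cons) /=.
- by rewrite fl (sml_lin hG [::]).
- by rewrite -fp.
- by rewrite fs (smlZ [::]) // [X in wdeg _ + X]addrCA.
Qed.

Lemma partition_sum_sml_param (H : seq LV -> seq LW -> Z) n w :
  (forall u, symmultilinear (H^~ u)) ->
  symmultilinear (fun a => partition_sum n (H a) w).
Proof.
move=> hH; split=> [s1 s2 k c u v|s1 s2 k u|s1 s2 k l u v].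
- rewrite -partition_sum_lin; apply: eq_partition_sum => t.
  exact: (sml_lin (hH t)).
- by apply: eq_partition_sum => t; apply: (sml_pr (hH t)).
- rewrite -partition_sumZ; apply: eq_partition_sum => t.
  exact: (sml_swap (hH t)).
Qed.

(** Either [x] and [y] share the first block, and [f] is symmetric; or they head the first two
    blocks, which are exchanged by coassociativity and cocommutativity of unshuffles and the
    symmetry of [G]. *)
Lemma partition_sum_swap n G x y w : symmultilinear G ->
  partition_sum n G (x :: y :: w)
  = sg K (x.1 * y.1) *: partition_sum n G (y :: x :: w).
Proof.
case: n => [|n] hG; first by rewrite /= scaler0.
have F_sml u := fletter_sml u hG.
rewrite /= !unsh_sum_cons scalerDr; congr (_ + _).
  rewrite -unsh_sumZ; apply: eq_unsh_sum => a b; rewrite -partition_sumZ.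
  by apply: eq_partition_sum => u; rewrite (sml_swap_head (F_sml u)).
case: n => [|n] /=.
  rewrite -unsh_sumZ; apply: eq_unsh_sum => a b; by rewrite !scaler0.
under eq_unsh_sum => a b do rewrite -unsh_sumZ.
under [X in _ = _ *: X]eq_unsh_sum => a b do rewrite -unsh_sumZ.
rewrite !unsh_sum_assoc -unsh_sumZ; apply: eq_unsh_sum => p e.
rewrite [X in _ = _ *: X]unsh_sum_comm -unsh_sumZ; apply: eq_unsh_sum => a c.
rewrite !scalerA -!partition_sumZ; apply: eq_partition_sum => u.
rewrite (sml_swap_head hG) /= scalerA -!sgD; congr (_ *: _).
rewrite !wdeg_cons -[RHS](sg_double_add _ _ (y.1 * wdeg a)); congr (sg K _); ring.
Qed.

Lemma partition_sum_sml n G : symmultilinear G -> symmultilinear (partition_sum n G).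
Proof.
elim: n G => [|n IH] G hG.
  by split=> [[|? ?] *|[|? ?] *|[|? ?] *]; rewrite /= ?scaler0 ?addr0.
have F_sml u := fletter_sml u hG.
have T_sml x : bisml (fun a b => partition_sum n (fun u => G (fletter (x :: a) :: u)) b).
  split=> [b|a]; last by apply: IH; apply: sml_cons.
  by apply: partition_sum_sml_param => u; apply: (sml_cons x (F_sml u)).
split=> [[|x s1] s2 k c u v|[|x s1] s2 k u|[|x s1] s2 k l u v].
- rewrite /= -unsh_sum_lin; apply: eq_unsh_sum => a b; rewrite -partition_sum_lin.
  by apply: eq_partition_sum => t; apply: (sml_lin (F_sml t) [::]).
- exact: (sml_lin (unsh_sum_sml (T_sml x))).
- apply: eq_unsh_sum => a b.
  by apply: eq_partition_sum => t; apply: (sml_pr (F_sml t) [::]).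
- exact: (sml_pr (unsh_sum_sml (T_sml x))).
- exact: (partition_sum_swap _ (k, u) (l, v)).
- exact: (sml_swap (unsh_sum_sml (T_sml x))).
Qed.

Lemma pullback_sml G : symmultilinear G -> symmultilinear (pullback G).
Proof.
move=> hG; split=> *; rewrite /pullback !size_cat /=.
- exact: (sml_lin (partition_sum_sml _ hG)).
- exact: (sml_pr (partition_sum_sml _ hG)).
- exact: (sml_swap (partition_sum_sml _ hG)).
Qed.

Lemma pullback_nil G : pullback G [::] = G [::].
Proof. by []. Qed.

Lemma pullback_cons G x w : pullback G (x :: w)
  = unsh_sum (fun a b => pullback (fun u => G (fletter (x :: a) :: u)) b) w.
Proof.
rewrite {1}/pullback /=; apply: eq_unsh_sum_in => a b ab _.
by apply: partition_sum_stable => //; rewrite -ab leq_addl.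
Qed.

Lemma eq_pullback G G' w : G =1 G' -> pullback G w = pullback G' w.
Proof. exact: eq_partition_sum. Qed.

Lemma pullback_lin G G' c w :
  pullback (fun u => c *: G u + G' u) w = c *: pullback G w + pullback G' w.
Proof. exact: partition_sum_lin. Qed.

Lemma pullbackD G G' w :
  pullback (fun u => G u + G' u) w = pullback G w + pullback G' w.
Proof.
rewrite -[X in X + _]scale1r -pullback_lin; apply: eq_pullback => u.
by rewrite scale1r.
Qed.

Lemma pullbackZ G c w : pullback (fun u => c *: G u) w = c *: pullback G w.
Proof. exact: partition_sumZ. Qed.

Lemma pullback0 w : pullback (fun _ => 0) w = 0.
Proof. exact: partition_sum0. Qed.

Lemma pullback_unsh (U : gmod K) (H : seq LW -> seq (letter U) -> seq (letter U) -> Z)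
    w e :
  pullback (fun u => unsh_sum (H u) e) w
  = unsh_sum (fun a b => pullback (fun u => H u a b) w) e.
Proof.
elim: e H => [|x e IH] H.
  by rewrite unsh_sum_nil; apply: eq_pullback => u; rewrite unsh_sum_nil.
rewrite unsh_sum_cons -IH.
under [X in _ = _ + X]eq_unsh_sum => a b do rewrite -pullbackZ.
by rewrite -IH -pullbackD; apply: eq_pullback => u; rewrite unsh_sum_cons.
Qed.

Lemma pullback_wdeg G (c : int -> K) w :
  pullback (fun u => c (wdeg u) *: G u) w = c (wdeg w) *: pullback G w.
Proof.
have [n] := ubnP (size w); elim: n w c G => // n IH [|x w] c G sw.
  by rewrite !pullback_nil /wdeg !big_nil.
rewrite !pullback_cons -unsh_sumZ; apply: eq_unsh_sum_in => a b ab dab.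
rewrite (@eq_pullback _ (fun u => c (wdeg (x :: a) + wdeg u)
    *: G (fletter (x :: a) :: u))); last by move=> u; rewrite wdeg_cons.
rewrite (IH b (fun m => c (wdeg (x :: a) + m))).
  by rewrite !wdeg_cons -dab addrA.
by rewrite (leq_ltn_trans _ (sw : (size w < n)%N)) // -ab leq_addl.
Qed.

Lemma pullback_nonempty0 G w : (forall y u, G (y :: u) = 0) ->
  pullback G w = if w is [::] then G [::] else 0.
Proof.
case: w => [|x w] h //; rewrite pullback_cons -[RHS](unsh_sum0 Z w).
apply: eq_unsh_sum => a b; rewrite -[RHS](pullback0 b).
by apply: eq_pullback.
Qed.

(** Used with [G] a corestriction, which sees only the partition with a single block. *)
Lemma pullback_size1 G x w : (forall y z u, G [:: y, z & u] = 0) ->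
  pullback G (x :: w) = G [:: fletter (x :: w)].
Proof.
move=> h; rewrite pullback_cons -[RHS](unsh_sum_nil_r (fun a => G [:: fletter (x :: a)])).
by apply: eq_unsh_sum => a b; rewrite pullback_nonempty0.
Qed.

End Values.

Lemma linear_pullback (Z Z' : lmodType K) (h : {linear Z -> Z'})
    (G : seq LW -> Z) w : h (pullback G w) = pullback (fun u => h (G u)) w.
Proof.
have [n] := ubnP (size w); elim: n w G => // n IH [|x w] G sw //.
rewrite !pullback_cons linear_unsh_sum; apply: eq_unsh_sum_in => a b ab _.
by rewrite IH // (leq_ltn_trans _ (sw : (size w < n)%N)) // -ab leq_addl.
Qed.

(** Splitting the set of blocks in two amounts to splitting [w] in two and partitioning both parts.
    The two summands record the side that receives the block of [x]. *)
Lemma pullback_comult (Z : lmodType K) (T : seq LW -> seq LW -> Z) w :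
  pullback (unsh_sum T) w
  = unsh_sum (fun a b => pullback (fun u => pullback (T u) b) a) w.
Proof.
have [n] := ubnP (size w); elim: n w T => // n IH [|x w] T sw.
  by rewrite !(pullback_nil, unsh_sum_nil).
rewrite pullback_cons unsh_sum_cons.
pose Y a b1 b2 :=
  pullback (fun u => pullback (fun v => T u (fletter (x :: a) :: v)) b2) b1.
transitivity (unsh_sum (fun a b => unsh_sum (fun b1 b2 =>
    pullback (fun u => pullback (T (fletter (x :: a) :: u)) b2) b1) b) w
  + unsh_sum (fun a b => unsh_sum (fun b1 b2 =>
    sg K ((x.1 + wdeg a) * wdeg b1) *: Y a b1 b2) b) w).
  rewrite -unsh_sumD; apply: eq_unsh_sum_in => a b ab _.
  rewrite (eq_pullback _ (fun u => unsh_sum_cons T (fletter (x :: a)) u)).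
  have sb : (size b < n)%N by rewrite (leq_ltn_trans _ (sw : (size w < n)%N)) // -ab leq_addl.
  rewrite pullbackD !IH //; congr (_ + _); apply: eq_unsh_sum => b1 b2.
  rewrite -(pullback_wdeg _ (fun m => sg K ((x.1 + wdeg a) * m))).
  by apply: eq_pullback => u; rewrite pullbackZ /= wdeg_cons.
rewrite !unsh_sum_assoc; congr (_ + _).
  by apply: eq_unsh_sum => c e; rewrite pullback_cons.
(* With the block of [x] on the right, [a] must be moved past the left part [b1]; cocommutativity
   does this and leaves only the sign of [x] passing [c]. *)
transitivity (unsh_sum (fun c e => unsh_sum (fun a b2 =>
    sg K (x.1 * wdeg c) *: Y a c b2) e) w).
  rewrite unsh_sum_assoc; apply: eq_unsh_sum => p b2.
  rewrite [RHS]unsh_sum_comm; apply: eq_unsh_sum => a c.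
  by rewrite scalerA -sgD mulrDl addrC.
apply: eq_unsh_sum => c e; rewrite unsh_sumZ -pullback_unsh; congr (_ *: _).
by apply: eq_pullback => u; rewrite pullback_cons.
Qed.

Definition cofree_map : {linear symp V -> symp W} :=
  symlift (@cword_nil K W : pullback (@cword K W) [::] = 0)
    (pullback_sml (@cword_sml K W)).

Lemma cofree_mapE w : cofree_map (cword w) = pullback (@cword K W) w.
Proof. exact: symlift_cword. Qed.

Lemma sdelta_cofree_map x : sdelta W (cofree_map x)
  = tmapl cofree_map cofree_map (sdelta V x).
Proof.
move: x; apply: (@cword_ext _ _ _ (sdelta W \o cofree_map)
  (tmapl cofree_map cofree_map \o sdelta V)) => w /=.
rewrite cofree_mapE linear_pullback sdelta_cword linear_unsh_sum.
rewrite (eq_pullback _ (@sdelta_cword K W)) pullback_comult.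
apply: eq_unsh_sum => a b; rewrite tmaplE !cofree_mapE.
symmetry; etransitivity.
  exact: (linear_pullback (mklin (@tns_linl _ _ _ (pullback _ b)))).
apply: eq_pullback => u.
exact: (linear_pullback (mklin (@tns_linr _ _ _ (cword u)))).
Qed.

Lemma cofree_map_deg : has_degree 0 cofree_map.
Proof.
move=> i x; rewrite addr0.
have gprE (U : gmod K) w : gpr (symp U) i (cword w) = (wdeg w == i)%:R *: cword w.
  by rewrite -(swscale_cword (fun m => (m == i)%:R)) swscale.unlock.
move: x; apply: (@cword_ext _ _ _ (cofree_map \o gpr (symp V) i)
  (gpr (symp W) i \o cofree_map)) => w /=.
rewrite gprE linearZ_LR cofree_mapE linear_pullback.
rewrite (eq_pullback _ (gprE W)).
by rewrite (pullback_wdeg _ (fun m => (m == i)%:R)).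
Qed.

End Cofree.

(** * Polynomial paths *)

Section PolynomialPaths.
Variables (K : fieldType) (M : lmodType K).
Implicit Types p q : K -> M.

(* [polyrel p p'] : [p] is a polynomial function with derivative [p']. *)
Inductive polyrel : (K -> M) -> (K -> M) -> Prop :=
| polyrel0 : polyrel 0 0
| polyrel_monom n v :
    polyrel (fun s => s ^+ n *: v) (fun s => (s ^+ n.-1 *+ n) *: v)
| polyrel_lin a p p' q q' : polyrel p p' -> polyrel q q' ->
    polyrel (a *: p + q) (a *: p' + q').

Lemma polyrelD p p' q q' :
  polyrel p p' -> polyrel q q' -> polyrel (p + q) (p' + q').
Proof. by move=> hp hq; have := polyrel_lin 1 hp hq; rewrite !scale1r. Qed.

Lemma polyrelB p p' q q' :
  polyrel p p' -> polyrel q q' -> polyrel (p - q) (p' - q').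
Proof.
move=> hp hq; have := polyrel_lin (-1) hq hp.
by rewrite !scaleN1r [_ + p]addrC [_ + p']addrC.
Qed.

Lemma polyrel_const (v : M) : polyrel (fun _ => v) 0.
Proof.
have := polyrel_monom 0 v.
have -> : (fun s : K => s ^+ 0 *: v) = fun _ => v.
  by apply/funext => s; rewrite expr0 scale1r.
have -> // : (fun s : K => (s ^+ 0.-1 *+ 0) *: v) = 0.
by apply/funext => s; rewrite mulr0n scale0r.
Qed.

Lemma polyrel_derivable p p' : polyrel p p' -> exists p'', polyrel p' p''.
Proof.
elim=> [|n v|a {}p {}p' q q' _ [r hr] _ [t ht]].
- by exists 0; apply: polyrel0.
- exists (fun s => (s ^+ n.-2 *+ n.-1) *: (n%:R *: v)).
  have := polyrel_monom n.-1 (n%:R *: v).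
  congr (polyrel _ _); apply/funext => s.
  by rewrite scalerA mulr_natr.
- by exists (a *: r + t); apply: polyrel_lin.
Qed.

(** The quantification over all large [n] allows two expansions to be added at a common length. *)
Lemma polyrel_coef p p' : polyrel p p' -> exists N (c : nat -> M),
  forall n, (N <= n)%N -> forall s, p s = \sum_(i < n) s ^+ i *: c i /\
    p' s = \sum_(i < n) (s ^+ i.-1 *+ i) *: c i.
Proof.
elim=> [|k v|a {}p {}p' q q' _ [N [c hc]] _ [L [e he]]].
- exists 0%N, (fun _ => 0) => n _ s; split.
    by rewrite big1 // => i _; rewrite scaler0.
  by rewrite big1 // => i _; rewrite scaler0.
- exists k.+1, (fun i => if i == k then v else 0) => n kn s; split.
    rewrite (bigD1 (Ordinal kn)) //= eqxx big1 ?addr0 // => i /negPf ik.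
    by rewrite -val_eqE /= in ik; rewrite ik scaler0.
  rewrite (bigD1 (Ordinal kn)) //= eqxx big1 ?addr0 // => i /negPf ik.
  by rewrite -val_eqE /= in ik; rewrite ik scaler0.
exists (maxn N L), (fun i => a *: c i + e i) => n.
rewrite geq_max => /andP[Nn Ln] s.
have [hp hp'] := hc n Nn s; have [hq hq'] := he n Ln s.
split; [rewrite -[LHS]/(a *: p s + q s) hp hq|rewrite -[LHS]/(a *: p' s + q' s) hp' hq'];
  rewrite scaler_sumr -big_split; apply: eq_bigr => i _ /=;
  by rewrite scalerDr !scalerA mulrC.
Qed.

Hypothesis char0 : [pchar K] =i pred0.

(** The value at [2 * s] minus [2 ^+ n] times the value at [s] eliminates the top coefficient and
    multiplies [c j] by [2 ^+ j - 2 ^+ n], nonzero in characteristic 0. *)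
Lemma poly_coef_eq0 n (c : nat -> M) :
  (forall s : K, \sum_(i < n) s ^+ i *: c i = 0) -> forall i, (i < n)%N -> c i = 0.
Proof.
elim: n c => [//|n IH] c h i.
have cn j : (j < n)%N -> c j = 0.
  move=> jn; have : (2 ^+ j - 2 ^+ n : K) *: c j = 0.
    apply: (IH (fun j => (2 ^+ j - 2 ^+ n) *: c j)) => // s.
    transitivity (\sum_(i < n.+1) (2 * s) ^+ i *: c i
                  - 2 ^+ n *: \sum_(i < n.+1) s ^+ i *: c i); last first.
      by rewrite !h scaler0 subrr.
    rewrite scaler_sumr -sumrB big_ord_recr /= exprMn scalerA subrr addr0.
    apply: eq_bigr => k _.
    by rewrite exprMn !scalerA -scalerBl mulrBr [s ^+ k * _]mulrC [s ^+ k * _]mulrC.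
  move/eqP; rewrite scaler_eq0 -!natrX => /orP[|/eqP//].
  rewrite -opprB oppr_eq0 -natrB ?leq_exp2l ?(ltnW jn) //.
  by rewrite ((pcharf0P K).1 char0) subn_eq0 leq_exp2l // leqNgt jn.
rewrite ltnS leq_eqVlt => /orP[/eqP->|/cn//].
have := h 1; rewrite big_ord_recr /= big1 => [|k _]; last by rewrite cn ?scaler0.
by rewrite add0r expr1n scale1r.
Qed.

Lemma polyrel_unique p q q' : polyrel p q -> polyrel p q' -> q = q'.
Proof.
move=> hq hq'; apply/eqP; rewrite -subr_eq0; apply/eqP/funext => s.
have := polyrelB hq hq'; rewrite subrr => /polyrel_coef[n [c /(_ n (leqnn n)) hc]].
have c0 : forall i, (i < n)%N -> c i = 0.
  by apply: poly_coef_eq0 => t; have [<-] := hc t.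
by have [_ ->] := hc s; apply: big1 => i _; rewrite c0 ?scaler0.
Qed.

Lemma polyrel0_const p : polyrel p 0 -> forall s t, p s = p t.
Proof.
move=> /polyrel_coef[n [c hn]].
have hc s := hn n.+1 (leqnSn n) s.
suff h s : p s = c 0%N by move=> s t; rewrite !h.
have c0 : forall i, (i < n)%N -> c i.+1 = 0.
  move=> i ni; have : (i.+1%:R : K) *: c i.+1 = 0.
    apply: (@poly_coef_eq0 n (fun i => i.+1%:R *: c i.+1)) => // t.
    have [_] := hc t; rewrite big_ord_recl mulr0n scale0r add0r => /esym h.
    rewrite -[RHS]h.
    by apply: eq_bigr => j _; rewrite scalerA mulr_natr.
  by move/eqP; rewrite scaler_eq0 ((pcharf0P K).1 char0) => /eqP.
have [-> _] := hc s; rewrite big_ord_recl big1 => [|i _].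
  by rewrite addr0 expr0 scale1r.
by rewrite c0 ?scaler0.
Qed.

Lemma polyrel_primitive p p' : polyrel p p' -> exists q, polyrel q p.
Proof.
elim=> [|n v|a {}p {}p' q q' _ [r hr] _ [t ht]].
- by exists 0; apply: polyrel0.
- exists (fun s => s ^+ n.+1 *: (n.+1%:R^-1 *: v)).
  have := polyrel_monom n.+1 (n.+1%:R^-1 *: v).
  congr (polyrel _ _); apply/funext => s.
  rewrite scalerA -mulr_natr -mulrA mulfV ?mulr1 //.
  by rewrite ((pcharf0P K).1 char0).
- by exists (a *: r + t); apply: polyrel_lin.
Qed.

Lemma polyrel_primitive_at p p' s0 v : polyrel p p' ->
  exists q, polyrel q p /\ q s0 = v.
Proof.
move=> /polyrel_primitive[q hq]; exists (q + fun _ => v - q s0).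
have h := polyrelD hq (polyrel_const (v - q s0)); rewrite addr0 in h.
by split=> //; rewrite -[LHS]/(q s0 + (v - q s0)) addrC subrK.
Qed.

End PolynomialPaths.

Section PolynomialMaps.
Variables (K : fieldType).

Lemma polyrel_linear (M N : lmodType K) (f : {linear M -> N}) p p' :
  polyrel p p' -> polyrel (fun s => f (p s)) (fun s => f (p' s)).
Proof.
elim=> [|n v|a {}p {}p' q q' _ hp _ hq].
- have -> : (fun s : K => f ((0 : K -> M) s)) = 0.
    by apply/funext => s; apply: linear0.
  exact: polyrel0.
- have := polyrel_monom n (f v); congr (polyrel _ _); apply/funext => s;
  by rewrite linearZ_LR.
- have := polyrel_lin a hp hq.
  by congr (polyrel _ _); apply/funext => s; apply/esym; apply: linearP.
Qed.

Section Bilinear.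
Variables (M N Q : lmodType K) (b : M -> N -> Q).
Hypotheses (bl : forall w, linear (b^~ w)) (br : forall u, linear (b u)).

Lemma polyrel_bilinear p p' q q' : polyrel p p' -> polyrel q q' ->
  polyrel (fun s => b (p s) (q s)) (fun s => b (p' s) (q s) + b (p s) (q' s)).
Proof.
have b0 w : b 0 w = 0 by exact: (linear0 (mklin (bl w))).
have bZ a u w : b (a *: u) w = a *: b u w by exact: (linearZ_LR (mklin (bl w))).
have bZr a u w : b u (a *: w) = a *: b u w by exact: (linearZ_LR (mklin (br u))).
have b0r u : b u 0 = 0 by exact: (linear0 (mklin (br u))).
move=> hp; elim: hp q q' => {p p'} [|n v|a p p' r r' _ IHp _ IHr] q q' hq.
- have -> : (fun s : K => b ((0 : K -> M) s) (q s)) = 0.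
    by apply/funext => s; apply: b0.
  have -> : (fun s : K => b ((0 : K -> M) s) (q s) + b ((0 : K -> M) s) (q' s)) = 0.
    by apply/funext => s; rewrite -[LHS]/(b 0 _ + b 0 _) !b0 addr0.
  exact: polyrel0.
- elim: hq => {q q'} [|m w|a q q' r r' _ IHp _ IHr].
  + have -> : (fun s : K => b (s ^+ n *: v) ((0 : K -> N) s)) = 0.
      by apply/funext => s; apply: b0r.
    have -> : (fun s : K => b ((s ^+ n.-1 *+ n) *: v) ((0 : K -> N) s)
        + b (s ^+ n *: v) ((0 : K -> N) s)) = 0.
      by apply/funext => s; rewrite -[LHS]/(b _ 0 + b _ 0) !b0r addr0.
    exact: polyrel0.
  + have := polyrel_monom (n + m) (b v w).
    congr (polyrel _ _); apply/funext => s; rewrite !bZ !bZr !scalerA -?scalerDl.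
      by rewrite exprD.
    (* The truncated predecessors in the exponents require the zero cases to be treated apart. *)
    congr (_ *: _); case: n m => [|n] [|m]; rewrite /= ?(mulr0n, mul0r, mulr0, addr0, add0r).
    * by [].
    * by rewrite expr0 mul1r.
    * by rewrite expr0 !addn0 mulr1.
    * by rewrite mulrnAl mulrnAr -!exprD (addSnnS n m) -mulrnDr.
  + have := polyrel_lin a IHp IHr; congr (polyrel _ _); apply/funext => s.
      rewrite -[RHS]/(b _ (a *: q s + r s)); apply/esym; exact: br.
    rewrite -[RHS]/(b _ (a *: q s + r s) + b _ (a *: q' s + r' s)) !br.
    by rewrite -[LHS]/(a *: (_ + _) + (_ + _)) scalerDr addrACA.
- have := polyrel_lin a (IHp _ _ hq) (IHr _ _ hq).
  congr (polyrel _ _); apply/funext => s.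
    rewrite -[RHS]/(b (a *: p s + r s) _); apply/esym; exact: bl.
  rewrite -[RHS]/(b (a *: p' s + r' s) _ + b (a *: p s + r s) _) !bl.
  by rewrite -[LHS]/(a *: (_ + _) + (_ + _)) scalerDr addrACA.
Qed.
End Bilinear.
End PolynomialMaps.

(** * Scaling the homogeneous components of a graded space *)

Section GradedScaling.
Variables (K : fieldType) (V : gmod K) (c : int -> K).

(** Any longer list also serves, so several elements can be expanded over one list. *)
Lemma gpr_support (x : V) : exists s : seq int, forall t, uniq t ->
  {subset s <= t} -> x = \sum_(i <- t) gpr V i x.
Proof.
have [s us hs] := gpr_sum x; exists s => t ut st.
have off j : j \notin s -> gpr V j x = 0.
  move=> js; rewrite hs linear_sum big_seq big1 // => i si.
  by rewrite gprI; case: eqP => // ji; rewrite ji si in js.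
rewrite (bigID (mem s)) /= [X in _ + X]big1 ?addr0 => [|i /off//].
rewrite -big_filter {1}hs; apply: perm_big; apply: uniq_perm => //.
  by rewrite filter_uniq.
by move=> i; rewrite mem_filter /=; case si: (i \in s); rewrite //= st.
Qed.

(** The support is a choice, on which the value does not depend by [gscale_funE]. *)
Definition gscale_fun (x : V) : V :=
  \sum_(i <- undup (projT1 (cid (gpr_support x)))) c i *: gpr V i x.

Lemma gscale_funE x s : uniq s -> x = \sum_(i <- s) gpr V i x ->
  gscale_fun x = \sum_(i <- s) c i *: gpr V i x.
Proof.
rewrite /gscale_fun; case: cid => t /= ht us hs.
have ut := undup_uniq t.
have off (r : seq int) j : uniq r -> x = \sum_(i <- r) gpr V i x ->
    j \notin r -> gpr V j x = 0.
  move=> ur hr jr; rewrite hr linear_sum big_seq big1 // => i ri.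
  by rewrite gprI; case: eqP => // ji; rewrite ji ri in jr.
have hr : x = \sum_(i <- undup t) gpr V i x by apply: ht => // i; rewrite mem_undup.
have common r r' : uniq r -> uniq r' -> x = \sum_(i <- r) gpr V i x ->
    \sum_(i <- r' | i \notin r) c i *: gpr V i x = 0.
  by move=> ur _ hr'; apply: big1 => i ir; rewrite (off r) ?scaler0.
rewrite (bigID (mem s)) /= (common s (undup t)) // addr0.
rewrite [RHS](bigID (mem (undup t))) /= (common (undup t) s) //.
rewrite addr0 -[LHS]big_filter -[RHS]big_filter.
apply: perm_big; apply: uniq_perm; rewrite ?filter_uniq //.
by move=> i; rewrite !mem_filter andbC.
Qed.

Lemma gscale_linear : linear gscale_fun.
Proof.
move=> a x y.
have [s hs] := gpr_support x; have [t ht] := gpr_support y.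
have [r hr] := gpr_support (a *: x + y).
pose u := undup (s ++ t ++ r).
have uu : uniq u by apply: undup_uniq.
rewrite !(@gscale_funE _ u) //.
- rewrite scaler_sumr -big_split; apply: eq_bigr => i _ /=.
  by rewrite linearP scalerDr !scalerA mulrC.
- by apply: ht => // i it; rewrite mem_undup !mem_cat it orbT.
- by apply: hs => // i it; rewrite mem_undup !mem_cat it.
- by apply: hr => // i it; rewrite mem_undup !mem_cat it !orbT.
Qed.

Definition gscale : {linear V -> V} := mklin gscale_linear.

Lemma gscale_homog i x : homog i x -> gscale x = c i *: x.
Proof.
move=> hx; rewrite [LHS](@gscale_funE x [:: i]) ?big_seq1 ?hx //.
Qed.
End GradedScaling.

(** * The space of polynomial paths and its calculus *)

Section PathSpace.
Variables (K : fieldType) (M : lmodType K).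

(** Elements of [M[t]] are kept as functions of t, the form in which the flow is given, so that
    equalities can be tested by evaluation. *)
Definition polyfun : {pred K -> M} := fun p => `[< exists p', polyrel p p' >].

Lemma polyfun_submod : subsemimod_closed polyfun.
Proof.
split; first split.
- by apply/asboolP; exists 0; apply: polyrel0.
- move=> p q /asboolP[p' hp] /asboolP[q' hq]; apply/asboolP.
  by exists (p' + q'); apply: polyrelD.
move=> a p /asboolP[p' hp]; apply/asboolP.
by exists (a *: p' + 0); rewrite -[a *: p]addr0; apply: polyrel_lin hp (polyrel0 _).
Qed.

HB.instance Definition _ := GRing.isSubmodClosed.Build K (K -> M) polyfun polyfun_submod.

Record ppath := Path { path_fun : K -> M; _ : path_fun \in polyfun }.

HB.instance Definition _ := [isSub for path_fun].
HB.instance Definition _ := [Choice of ppath by <:].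
HB.instance Definition _ := [SubChoice_isSubLmodule of ppath by <:].

Lemma pev_linear s : linear (fun p : ppath => path_fun p s).
Proof. by move=> a p q; rewrite -[path_fun (_ + _)]/(val (_ + _)) linearP. Qed.

Lemma path_ext (p q : ppath) : (forall s, path_fun p s = path_fun q s) -> p = q.
Proof. by move=> h; apply: val_inj; apply/funext. Qed.

Definition mkpath (p p' : K -> M) (h : polyrel p p') : ppath :=
  @Path p (introT (asboolP _) (ex_intro _ p' h)).
End PathSpace.

HB.lock Definition pev (K : fieldType) (M : lmodType K) (s : K) : {linear ppath M -> M} :=
  mklin (@pev_linear K M s).

Section PathMaps.
Variables (K : fieldType).

Lemma pev_ext (M : lmodType K) (p q : ppath M) :
  (forall s, pev M s p = pev M s q) -> p = q.
Proof. by rewrite unlock => h; apply: path_ext. Qed.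

Lemma pev_mkpath (M : lmodType K) (p p' : K -> M) (h : polyrel p p') s :
  pev M s (mkpath h) = p s.
Proof. by rewrite unlock. Qed.

Lemma ppathP (M : lmodType K) (p : ppath M) : exists p', polyrel (pev M ^~ p) p'.
Proof. by case: p => p hp; have /asboolP[p' h] := hp; exists p'; rewrite unlock. Qed.

Definition pconst (M : lmodType K) (v : M) : ppath M := mkpath (polyrel_const v).

Lemma pev_const (M : lmodType K) (v : M) s : pev M s (pconst v) = v.
Proof. exact: pev_mkpath. Qed.

Lemma pconst_linear (M : lmodType K) : linear (@pconst M).
Proof. by move=> a u v; apply: pev_ext => s; rewrite linearP !pev_const. Qed.

Section Linear.
Variables (M N : lmodType K) (f : {linear M -> N}).

Lemma pathmap_subproof (p : ppath M) : exists q : ppath N, forall s, pev N s q = f (pev M s p).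
Proof.
have [p' h] := ppathP p; exists (mkpath (polyrel_linear f h)) => s.
by rewrite pev_mkpath.
Qed.

Definition pathmap_fun (p : ppath M) : ppath N := projT1 (cid (pathmap_subproof p)).

Lemma pev_pathmap_fun s p : pev N s (pathmap_fun p) = f (pev M s p).
Proof. by rewrite /pathmap_fun; case: cid. Qed.

Lemma pathmap_linear : linear pathmap_fun.
Proof. by move=> a p q; apply: pev_ext => s; rewrite linearP !pev_pathmap_fun !linearP. Qed.
End Linear.

Section Bilinear.
Variables (M N Q : lmodType K) (b : M -> N -> Q).
Hypotheses (bl : forall w, linear (b^~ w)) (br : forall u, linear (b u)).

Lemma pbil_subproof (p : ppath M) (q : ppath N) :
  exists r : ppath Q, forall s, pev Q s r = b (pev M s p) (pev N s q).
Proof.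
have [p' hp] := ppathP p; have [q' hq] := ppathP q.
by exists (mkpath (polyrel_bilinear bl br hp hq)) => s; rewrite pev_mkpath.
Qed.

Definition pbil (p : ppath M) (q : ppath N) : ppath Q := projT1 (cid (pbil_subproof p q)).

Lemma pev_pbil s p q : pev Q s (pbil p q) = b (pev M s p) (pev N s q).
Proof. by rewrite /pbil; case: cid. Qed.
End Bilinear.

Section Derivative.
Hypothesis char0 : [pchar K] =i pred0.
Variable M : lmodType K.

Lemma pder_subproof (p : ppath M) :
  exists q : ppath M, polyrel (pev M ^~ p) (pev M ^~ q).
Proof.
have [p' h] := ppathP p; have [p'' h'] := polyrel_derivable h.
exists (mkpath h'); move: h; congr polyrel; apply/funext => s.
by rewrite pev_mkpath.
Qed.

Definition pder_fun (p : ppath M) : ppath M := projT1 (cid (pder_subproof p)).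

Lemma pder_funP p : polyrel (pev M ^~ p) (pev M ^~ (pder_fun p)).
Proof. by rewrite /pder_fun; case: cid. Qed.

Lemma pder_fun_eq p q : polyrel (pev M ^~ p) (pev M ^~ q) -> pder_fun p = q.
Proof.
move=> h; apply: pev_ext => s.
by have := polyrel_unique char0 (pder_funP p) h => /(congr1 (fun f => f s)).
Qed.

Lemma pder_linear : linear pder_fun.
Proof.
move=> a p q; apply: pder_fun_eq.
have := polyrel_lin a (pder_funP p) (pder_funP q).
by congr polyrel; apply/funext => s; rewrite linearP.
Qed.
End Derivative.
End PathMaps.

HB.lock Definition pathmap (K : fieldType) (M N : lmodType K) (f : {linear M -> N}) :
  {linear ppath M -> ppath N} := mklin (pathmap_linear f).

HB.lock Definition pder (K : fieldType) (char0 : [pchar K] =i pred0) (M : lmodType K) :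
  {linear ppath M -> ppath M} := mklin (@pder_linear K char0 M).

Section PathCalculus.
Variables (K : fieldType) (char0 : [pchar K] =i pred0).
Local Notation pder := (pder char0).

Lemma pev_pathmap (M N : lmodType K) (f : {linear M -> N}) s p :
  pev N s (pathmap f p) = f (pev M s p).
Proof. by rewrite pathmap.unlock; apply: pev_pathmap_fun. Qed.

Lemma pderP (M : lmodType K) (p : ppath M) : polyrel (pev M ^~ p) (pev M ^~ (pder M p)).
Proof. by rewrite pder.unlock; apply: pder_funP. Qed.

Lemma pder_eq (M : lmodType K) (p q : ppath M) :
  polyrel (pev M ^~ p) (pev M ^~ q) -> pder M p = q.
Proof. by rewrite pder.unlock; apply: pder_fun_eq. Qed.

Lemma pder_pathmap (M N : lmodType K) (f : {linear M -> N}) p :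
  pder N (pathmap f p) = pathmap f (pder M p).
Proof.
apply: pder_eq; have := polyrel_linear f (pderP p).
by congr polyrel; apply/funext => s; rewrite pev_pathmap.
Qed.

Lemma pder_const (M : lmodType K) (v : M) : pder M (pconst v) = 0.
Proof.
apply: pder_eq; have := polyrel_const v.
by congr polyrel; apply/funext => s; rewrite ?pev_const ?linear0.
Qed.

Lemma pder_eq0 (M : lmodType K) (p : ppath M) s t :
  pder M p = 0 -> pev M s p = pev M t p.
Proof.
move=> h; have := pderP p; rewrite h => hp.
apply: (polyrel0_const char0 (p := pev M ^~ p)).
by move: hp; congr polyrel; apply/funext => r; rewrite linear0.
Qed.

Lemma pder_primitive (M : lmodType K) (p : ppath M) s v :
  exists q, pder M q = p /\ pev M s q = v.
Proof.
have [p' hp] := ppathP p.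
have [q [hq qs]] := polyrel_primitive_at char0 s v hp.
exists (mkpath hq); split; last by rewrite pev_mkpath.
apply: pder_eq; have := hq; congr polyrel.
by apply/funext => t; rewrite pev_mkpath.
Qed.

Lemma pder_pbil (M N Q : lmodType K) (b : M -> N -> Q)
    (bl : forall w, linear (b^~ w)) (br : forall u, linear (b u)) p q :
  pder Q (pbil bl br p q) = pbil bl br (pder M p) q + pbil bl br p (pder N q).
Proof.
apply: pder_eq; have := polyrel_bilinear bl br (pderP p) (pderP q).
by congr polyrel; apply/funext => s; rewrite ?linearD /= !pev_pbil.
Qed.
End PathCalculus.

(** * Polynomial differential forms with values in a dg Lie algebra *)

Lemma addr6CA (Z : zmodType) (a b c d e f : Z) :
  a + (b + (c + (d + (e + f)))) = a + (c + (e + (d + (b + f)))).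
Proof.
by congr (_ + _); rewrite (addrCA b c) (addrCA d e) (addrCA b e) (addrCA b d).
Qed.

Section PathObject.
Variables (K : fieldType) (char0 : [pchar K] =i pred0).

Section Graded.
Variable V : gmod K.

Definition pobj_car : lmodType K := (ppath V * ppath V)%type.

Lemma pobj_ext (x y : pobj_car) : (forall s, pev V s x.1 = pev V s y.1) ->
  (forall s, pev V s x.2 = pev V s y.2) -> x = y.
Proof. by case: x y => [a b] [c e] /= /pev_ext -> /pev_ext ->. Qed.

(** The form dt has degree 1, hence [k - 1] in the second component. *)
Definition pobj_pr_fun (k : int) (x : pobj_car) : pobj_car :=
  (pathmap (gpr V k) x.1, pathmap (gpr V (k - 1)) x.2).

Lemma pobj_pr_linear k : linear (pobj_pr_fun k).
Proof. by move=> a x y; rewrite /pobj_pr_fun /= !linearP. Qed.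

Definition pobj_pr k : {linear pobj_car -> pobj_car} := mklin (pobj_pr_linear k).

Lemma pobj_prI i j x :
  pobj_pr i (pobj_pr j x) = if i == j then pobj_pr j x else 0.
Proof.
apply: pobj_ext => s /=; rewrite !pev_pathmap gprI ?(inj_eq (addIr (-1)));
  by case: (i == j); rewrite /= ?pev_pathmap ?linear0.
Qed.

(** A polynomial path has finitely many coefficients, so one finite list of degrees serves all [s]
    at once. *)
Lemma polyrel_support (p p' : K -> V) : polyrel p p' ->
  exists r : seq int, forall t, uniq t -> {subset r <= t} ->
    forall s, p s = \sum_(i <- t) gpr V i (p s).
Proof.
elim=> [|n v|a {}p {}p' q q' _ [r hr] _ [t ht]].
- by exists [::] => t _ _ s; rewrite big1 // => i _; apply: linear0.
- have [r hr] := gpr_support v; exists r => t ut rt s.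
  rewrite {1}(hr t ut rt) scaler_sumr; apply: eq_bigr => i _.
  by rewrite linearZ_LR.
exists (r ++ t) => u uu sub s.
rewrite -[LHS]/(a *: p s + q s) (hr u) // => [|i ir]; last first.
  by apply: sub; rewrite mem_cat ir.
rewrite [X in _ + X](ht u) // => [|i it]; last by apply: sub; rewrite mem_cat it orbT.
rewrite scaler_sumr -big_split; apply: eq_bigr => i _ /=.
by rewrite -linearP.
Qed.

Lemma path_support (p : ppath V) : exists r : seq int, forall t, uniq t ->
  {subset r <= t} -> p = \sum_(i <- t) pathmap (gpr V i) p.
Proof.
have [p' hp] := ppathP p; have [r hr] := polyrel_support hp; exists r => t ut rt.
apply: pev_ext => s; rewrite linear_sum [LHS](hr t) //.
by apply: eq_bigr => i _; rewrite pev_pathmap.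
Qed.

Lemma pobj_pr_sum x :
  exists2 s : seq int, uniq s & x = \sum_(i <- s) pobj_pr i x.
Proof.
have [r hr] := path_support x.1; have [t ht] := path_support x.2.
pose u := undup (r ++ [seq i + 1 | i <- t]).
have uu : uniq u by apply: undup_uniq.
exists u => //.
have sumE (l : seq int) : \sum_(i <- l) pobj_pr i x
    = (\sum_(i <- l) pathmap (gpr V i) x.1, \sum_(i <- l) pathmap (gpr V (i - 1)) x.2).
  by elim: l => [|i l IH]; rewrite ?big_nil // !big_cons IH.
rewrite sumE {1}[x]surjective_pairing; congr (_, _).
  by apply: hr => // i ir; rewrite mem_undup mem_cat ir.
rewrite -(big_map (fun i => i - 1) predT (fun i => pathmap (gpr V i) x.2)).
apply: ht; first by rewrite map_inj_uniq //; apply: addIr.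
move=> i it; apply/mapP; exists (i + 1); last by rewrite addrK.
by rewrite mem_undup mem_cat (map_f (fun i => i + 1)) // orbT.
Qed.

Definition pobj : gmod K := GMod pobj_prI pobj_pr_sum.

Lemma pobj_homog i (x : pobj) : homog i x ->
  (forall s, homog i (pev V s x.1)) /\ (forall s, homog (i - 1) (pev V s x.2)).
Proof.
move=> h; split=> s; rewrite /homog -pev_pathmap; congr (pev _ _ _).
  exact: (congr1 fst h).
exact: (congr1 snd h).
Qed.
End Graded.

Variable h : dgLie K.
Local Notation sigma := (gscale h (sg K)).
Local Notation brk := (pbil (@dgl_br_linl K h) (@dgl_br_linr K h)).

Let brl := @dgl_br_linl K h.
Let brr := @dgl_br_linr K h.

(* The pair (a, b) stands for a + dt b in h[t, dt]. *)
Definition pobj_d_fun (x : pobj h) : pobj h :=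
  (pathmap (dgl_d h) x.1, pder char0 h x.1 - pathmap (dgl_d h) x.2).

Lemma pobj_d_linear : linear pobj_d_fun.
Proof.
move=> a x y; rewrite /pobj_d_fun /= !linearP.
by congr (_, _); rewrite -[RHS]/(a *: (_ - _) + (_ - _)) scalerDr addrACA.
Qed.

Definition pobj_d : {linear pobj h -> pobj h} := mklin pobj_d_linear.

(** The bracket of a + dt b and a' + dt b'; [sigma] is the sign of moving a past dt. *)
Definition pobj_br (x y : pobj h) : pobj h :=
  (brk x.1 y.1, brk x.2 y.1 + brk (pathmap sigma x.1) y.2).

Lemma pobj_pr1 (V : gmod K) i (x : pobj V) s :
  pev V s (gpr (pobj V) i x).1 = gpr V i (pev V s x.1).
Proof. exact: pev_pathmap. Qed.

Lemma pobj_pr2 (V : gmod K) i (x : pobj V) s :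
  pev V s (gpr (pobj V) i x).2 = gpr V (i - 1) (pev V s x.2).
Proof. exact: pev_pathmap. Qed.

Lemma pobj_lin1 (V : gmod K) a (x y : pobj V) s :
  pev V s (a *: x + y).1 = a *: pev V s x.1 + pev V s y.1.
Proof. exact: linearP. Qed.

Lemma pobj_lin2 (V : gmod K) a (x y : pobj V) s :
  pev V s (a *: x + y).2 = a *: pev V s x.2 + pev V s y.2.
Proof. exact: linearP. Qed.

Lemma pobjD1 (V : gmod K) (x y : pobj V) s :
  pev V s (x + y).1 = pev V s x.1 + pev V s y.1.
Proof. exact: linearD. Qed.

Lemma pobjD2 (V : gmod K) (x y : pobj V) s :
  pev V s (x + y).2 = pev V s x.2 + pev V s y.2.
Proof. exact: linearD. Qed.

Lemma pobjZ1 (V : gmod K) a (x : pobj V) s :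
  pev V s (a *: x).1 = a *: pev V s x.1.
Proof. exact: linearZ_LR. Qed.

Lemma pobjZ2 (V : gmod K) a (x : pobj V) s :
  pev V s (a *: x).2 = a *: pev V s x.2.
Proof. exact: linearZ_LR. Qed.

Lemma pobjN1 (V : gmod K) (x : pobj V) s :
  pev V s (- x).1 = - pev V s x.1.
Proof. exact: linearN. Qed.

Lemma pobjN2 (V : gmod K) (x : pobj V) s :
  pev V s (- x).2 = - pev V s x.2.
Proof. exact: linearN. Qed.

Lemma pobj_d1 x s : pev h s (pobj_d x).1 = dgl_d h (pev h s x.1).
Proof. exact: pev_pathmap. Qed.

Lemma pobj_d2 x s :
  pev h s (pobj_d x).2 = pev h s (pder char0 h x.1) - dgl_d h (pev h s x.2).
Proof. by rewrite -pev_pathmap -linearB. Qed.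

Lemma pobj_br1 x y s :
  pev h s (pobj_br x y).1 = dgl_br (pev h s x.1) (pev h s y.1).
Proof. exact: pev_pbil. Qed.

Lemma pobj_br2 x y s :
  pev h s (pobj_br x y).2 = dgl_br (pev h s x.2) (pev h s y.1)
    + dgl_br (sigma (pev h s x.1)) (pev h s y.2).
Proof. by rewrite -pev_pathmap -2!(pev_pbil brl brr) -linearD. Qed.

Lemma pder_pr1 i x s :
  pev h s (pder char0 h (gpr (pobj h) i x).1) = gpr h i (pev h s (pder char0 h x.1)).
Proof. by rewrite -pev_pathmap -pder_pathmap. Qed.

Lemma pder_d1 x s :
  pev h s (pder char0 h (pobj_d x).1) = dgl_d h (pev h s (pder char0 h x.1)).
Proof. by rewrite -pev_pathmap -pder_pathmap. Qed.

Lemma pder_br1 x y s : pev h s (pder char0 h (pobj_br x y).1)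
  = dgl_br (pev h s (pder char0 h x.1)) (pev h s y.1)
    + dgl_br (pev h s x.1) (pev h s (pder char0 h y.1)).
Proof.
by rewrite -2!(pev_pbil brl brr) -(linearD (pev h s)) -pder_pbil.
Qed.

Lemma pobj_d_deg : has_degree 1 pobj_d.
Proof.
move=> i x; apply: pobj_ext => s; first by rewrite pobj_d1 !pobj_pr1 pobj_d1 dgl_d_deg.
rewrite pobj_d2 !pobj_pr2 pobj_d2 pder_pr1 (linearB (gpr h _)).
by rewrite dgl_d_deg; congr (gpr h _ _ - gpr h _ _); ring.
Qed.

Lemma pobj_dd x : pobj_d (pobj_d x) = 0.
Proof.
apply: pobj_ext => s; rewrite linear0; first by rewrite !pobj_d1 dgl_dd.
by rewrite pobj_d2 pobj_d2 pder_d1 (linearB (dgl_d h)) dgl_dd subr0 subrr.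
Qed.

Lemma pobj_br_linl y : linear (pobj_br^~ y).
Proof.
move=> a x z; apply: pobj_ext => s.
  by rewrite pobj_lin1 !pobj_br1 pobj_lin1 brl.
rewrite pobj_lin2 !pobj_br2 pobj_lin1 pobj_lin2 linearP !brl.
by rewrite scalerDr addrACA.
Qed.

Lemma pobj_br_linr x : linear (pobj_br x).
Proof.
move=> a y z; apply: pobj_ext => s.
  by rewrite pobj_lin1 !pobj_br1 pobj_lin1 brr.
rewrite pobj_lin2 !pobj_br2 pobj_lin1 pobj_lin2 !brr.
by rewrite scalerDr addrACA.
Qed.

Lemma dgl_br0l y : dgl_br 0 y = 0 :> h.
Proof. exact: (linear0 (mklin (brl y))). Qed.

Lemma dgl_br0r x : dgl_br x 0 = 0 :> h.
Proof. exact: (linear0 (mklin (brr x))). Qed.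

Lemma dgl_brZl a x y : dgl_br (a *: x) y = a *: dgl_br x y :> h.
Proof. exact: (linearZ_LR (mklin (brl y))). Qed.

Lemma dgl_brZr a x y : dgl_br x (a *: y) = a *: dgl_br x y :> h.
Proof. exact: (linearZ_LR (mklin (brr x))). Qed.

Lemma dgl_brDl x x' y : dgl_br (x + x') y = dgl_br x y + dgl_br x' y :> h.
Proof. exact: (linearD (mklin (brl y))). Qed.

Lemma dgl_brDr x y y' : dgl_br x (y + y') = dgl_br x y + dgl_br x y' :> h.
Proof. exact: (linearD (mklin (brr x))). Qed.

Lemma dgl_brBl x x' y : dgl_br (x - x') y = dgl_br x y - dgl_br x' y :> h.
Proof. exact: (linearB (mklin (brl y))). Qed.

Lemma dgl_brBr x y y' : dgl_br x (y - y') = dgl_br x y - dgl_br x y' :> h.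
Proof. exact: (linearB (mklin (brr x))). Qed.

Lemma homogZ (V : gmod K) i a (x : V) : homog i x -> homog i (a *: x).
Proof. by move=> hx; rewrite /homog linearZ_LR hx. Qed.

Lemma homogD (V : gmod K) i (x y : V) : homog i x -> homog i y -> homog i (x + y).
Proof. by move=> hx hy; rewrite /homog linearD hx hy. Qed.

Lemma pobj_br_deg i j (x y : pobj h) : homog i x -> homog j y ->
  homog (i + j) (pobj_br x y).
Proof.
move=> /pobj_homog[x1 x2] /pobj_homog[y1 y2]; apply: pobj_ext => s.
  by rewrite pobj_pr1 pobj_br1; apply: dgl_br_deg.
rewrite pobj_pr2 pobj_br2 (gscale_homog _ (x1 s)) dgl_brZl; apply: homogD.
  have -> : i + j - 1 = (i - 1) + j by ring.
  exact: dgl_br_deg.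
apply: homogZ; have -> : i + j - 1 = i + (j - 1) by ring.
exact: dgl_br_deg.
Qed.

Lemma sgB1 n : sg K (n - 1) = - sg K n.
Proof. by rewrite sgD sgN sg1 mulrN1. Qed.

Lemma pobj_antisym i j (x y : pobj h) : homog i x -> homog j y ->
  pobj_br x y = - (sg K (i * j) *: pobj_br y x).
Proof.
move=> /pobj_homog[x1 x2] /pobj_homog[y1 y2]; apply: pobj_ext => s.
  rewrite pobjN1 pobjZ1 !pobj_br1.
  exact: dgl_antisym.
rewrite pobjN2 pobjZ2 !pobj_br2.
rewrite (gscale_homog _ (x1 s)) (gscale_homog _ (y1 s)) !dgl_brZl.
rewrite (dgl_antisym (x2 s) (y1 s)) (dgl_antisym (x1 s) (y2 s)).
rewrite addrC -!scaleNr scalerDr !scalerA; congr (_ *: _ + _ *: _).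
  by rewrite mulrBr mulr1 sgD sgN; case: (sg_or K i) => ->; ring.
by rewrite mulrBl mul1r sgD sgN; ring.
Qed.

(** The dt-component consists of three Jacobi identities of [h], one for each entry that can carry
    dt. *)
Lemma pobj_jacobi i j (x y z : pobj h) : homog i x -> homog j y ->
  pobj_br x (pobj_br y z)
  = pobj_br (pobj_br x y) z + sg K (i * j) *: pobj_br y (pobj_br x z).
Proof.
move=> hx hy; have [x1 x2] := pobj_homog hx; have [y1 y2] := pobj_homog hy.
have [xy _] := pobj_homog (pobj_br_deg hx hy).
apply: pobj_ext => s.
  rewrite pobjD1 pobjZ1 !pobj_br1.
  exact: dgl_jacobi.
rewrite pobjD2 pobjZ2 !pobj_br2 (gscale_homog _ (xy s)).
rewrite !pobj_br1.
rewrite (gscale_homog _ (x1 s)) (gscale_homog _ (y1 s)).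
rewrite !(dgl_brZl, dgl_brZr, dgl_brDl, dgl_brDr).
rewrite (dgl_jacobi _ (x2 s) (y1 s)) (dgl_jacobi _ (x1 s) (y2 s)).
rewrite (dgl_jacobi _ (x1 s) (y1 s)) !scalerDr !scalerA.
rewrite -!addrA [LHS]addr6CA.
congr (_ + (_ + (_ *: _ + (_ *: _ + (_ *: _ + _ *: _))))).
- by rewrite sgD.
- by rewrite mulrBr mulr1 sgD sgN; case: (sg_or K i) => ->; ring.
- by rewrite mulrBl mul1r sgD sgN.
- by ring.
Qed.

(** The dt-component combines the product rule for d/dt with two Leibniz rules of [h]. *)
Lemma pobj_leibniz i (x y : pobj h) : homog i x ->
  pobj_d (pobj_br x y) = pobj_br (pobj_d x) y + sg K i *: pobj_br x (pobj_d y).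
Proof.
move=> /pobj_homog[x1 x2]; apply: pobj_ext => s.
  rewrite pobjD1 pobjZ1 pobj_d1 !pobj_br1 !pobj_d1.
  exact: dgl_leibniz.
rewrite pobjD2 pobjZ2 pobj_d2 !pobj_br2 !pobj_d1.
rewrite !pobj_d2 pder_br1.
have dx : homog (i + 1) (dgl_d h (pev h s x.1)) by rewrite /homog -dgl_d_deg x1.
rewrite (gscale_homog _ (x1 s)) (gscale_homog _ dx).
rewrite !(dgl_brZl, dgl_brZr, dgl_brBl, dgl_brBr) (linearD (dgl_d h)).
rewrite (linearZ_LR (dgl_d h)) (dgl_leibniz _ (x2 s)) (dgl_leibniz _ (x1 s)).
rewrite !scalerDr !scalerA sgsq !scale1r sgB1 sgD sg1 mulrN1 !scaleNr.
by rewrite !opprD opprK -!addrA [LHS]addr6CA.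
Qed.

Definition path_dgLie : dgLie K :=
  DGLie pobj_d_deg pobj_dd pobj_br_linl pobj_br_linr pobj_br_deg pobj_antisym
    pobj_jacobi pobj_leibniz.

End PathObject.

Section LinfFromLocked.
Variables (K : fieldType).
Implicit Types g h : dgLie K.

Lemma linf_ced g h (p : linf g h) x : p (ced g x) = ced h (p x).
Proof. by rewrite unlock; apply: linf_d. Qed.

Lemma linf_sdelta g h (p : linf g h) x :
  sdelta (shift 1 h) (p x) = tmapl p p (sdelta (shift 1 g) x).
Proof. by rewrite !unlock; apply: linf_delta. Qed.

Lemma taylorE g h (p : linf g h) x : taylor p x = ceproj h (p x).
Proof. by rewrite unlock. Qed.

(** Transparent, so that the underlying map reduces to [f]. *)
Definition mklinf g h (f : {linear cbar g -> cbar h}) (f_deg : has_degree 0 f)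
    (f_d : forall x, f (ced g x) = ced h (f x))
    (f_delta : forall x, sdelta (shift 1 h) (f x) = tmapl f f (sdelta (shift 1 g) x)) :
  linf g h.
Proof.
apply: (@Linf _ g h f f_deg) => x; first by have := f_d x; rewrite unlock.
by have := f_delta x; rewrite !unlock.
Defined.
End LinfFromLocked.

(** * Strict morphisms *)

Section StrictMorphism.
Variables (K : fieldType) (g h : dgLie K) (f : {linear g -> h}).
Hypotheses (f_pr : forall i x, f (gpr g i x) = gpr h i (f x))
  (f_d : forall x, f (dgl_d g x) = dgl_d h (f x))
  (f_br : forall x y, f (dgl_br x y) = dgl_br (f x) (f y)).
Local Notation Lg := (letter (shift 1 g)).
Local Notation Lh := (letter (shift 1 h)).

Definition letter_map (x : Lg) : Lh := (x.1, f x.2).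
Local Notation wmap := (map letter_map).

Lemma wdeg_map w : wdeg (wmap w) = wdeg w.
Proof. by rewrite /wdeg big_map. Qed.

Lemma strict_sml : symmultilinear (fun w => @cword K (shift 1 h) (wmap w)).
Proof.
have [fl fp fs] := @cword_sml K (shift 1 h).
split=> *; rewrite !map_cat /= /letter_map /=.
- by rewrite linearP fl.
- by rewrite fp [RHS]fp /= /shift_pr f_pr gprI eqxx.
- exact: fs.
Qed.

Definition strict_map : {linear cbar g -> cbar h} :=
  symlift (@cword_nil K (shift 1 h) : cword (wmap [::]) = 0) strict_sml.

Lemma strict_mapE w : strict_map (cword w) = cword (wmap w).
Proof. exact: symlift_cword. Qed.

Lemma letter_map_br x y :
  letter_map (letter_br x y) = letter_br (letter_map x) (letter_map y).
Proof. by rewrite /letter_map /letter_br /= linearZ_LR /= f_br !f_pr. Qed.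

Lemma letter_map_d x : letter_map (letter_d x) = letter_d (letter_map x).
Proof. by rewrite /letter_map /letter_d /= linearN /= f_d. Qed.

Lemma br_sum_map (Z : lmodType K) (G : seq Lh -> Z) x w :
  br_sum G (letter_map x) (wmap w) = br_sum (fun v => G (wmap v)) x w.
Proof.
elim: w G => [|y w IH] G; first by rewrite !br_sum_nil.
by rewrite /= !br_sum_cons /= letter_map_br -(IH (fun v => G (_ :: v))).
Qed.

Lemma d_sum_map (Z : lmodType K) (G : seq Lh -> Z) w :
  d_sum G (wmap w) = d_sum (fun v => G (wmap v)) w.
Proof.
elim: w G => [|y w IH] G; first by rewrite !d_sum_nil.
by rewrite /= !d_sum_cons /= letter_map_d br_sum_map -(IH (fun v => G (_ :: v))).
Qed.

Lemma unsh_sum_map (Z : lmodType K) (G : seq Lh -> seq Lh -> Z) w :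
  unsh_sum G (wmap w) = unsh_sum (fun a b => G (wmap a) (wmap b)) w.
Proof.
elim: w G => [|y w IH] G; first by rewrite !unsh_sum_nil.
rewrite /= !unsh_sum_cons !IH; congr (_ + _).
by apply: eq_unsh_sum => a b; rewrite wdeg_map.
Qed.

Lemma strict_map_deg : has_degree 0 strict_map.
Proof.
move=> i x; rewrite addr0.
move: x; apply: (@cword_ext _ _ _ (strict_map \o gpr (cbar g) i)
  (gpr (cbar h) i \o strict_map)) => w /=.
by rewrite gpr_cword linearZ_LR strict_mapE gpr_cword wdeg_map.
Qed.

Lemma strict_map_d x : strict_map (ced g x) = ced h (strict_map x).
Proof.
move: x; apply: (@cword_ext _ _ _ (strict_map \o ced g) (ced h \o strict_map)) => w /=.
rewrite ced_cword linear_d_sum strict_mapE ced_cword d_sum_map.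
by apply: eq_d_sum => v; rewrite strict_mapE.
Qed.

Lemma strict_map_delta x : sdelta (shift 1 h) (strict_map x)
  = tmapl strict_map strict_map (sdelta (shift 1 g) x).
Proof.
move: x; apply: (@cword_ext _ _ _ (sdelta _ \o strict_map)
  (tmapl strict_map strict_map \o sdelta _)) => w /=.
rewrite strict_mapE !sdelta_cword linear_unsh_sum unsh_sum_map.
by apply: eq_unsh_sum => a b; rewrite tmaplE !strict_mapE.
Qed.

Definition strict_linf : linf g h :=
  mklinf strict_map_deg strict_map_d strict_map_delta.

Lemma strict_linfE x : strict_linf x = strict_map x.
Proof. by []. Qed.

Lemma ceproj_strict x : ceproj h (strict_map x) = f (ceproj g x).
Proof.
move: x; apply: (@cword_ext _ _ _ (ceproj h \o strict_map) (f \o ceproj g)) => w /=.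
rewrite strict_mapE !ceproj_cword; case: w => [|x [|y w]] /=; rewrite ?linear0 //.
by rewrite /shift_pr f_pr.
Qed.

Lemma taylor1_strict n x : taylor1 strict_linf n x = gpr h n (f x).
Proof.
rewrite /taylor1 taylorE strict_linfE.
have -> : @word K (shift 1 g) [:: (n - 1, x)] = @cword K (shift 1 g) [:: (n - 1, x)] by rewrite unlock.
rewrite ceproj_strict ceproj_cword /= /shift_pr f_pr; congr (gpr h _ _); ring.
Qed.
End StrictMorphism.

(** * Evaluation of forms at a point and inclusion of constants *)

Section PathEvaluation.
Variables (K : fieldType) (char0 : [pchar K] =i pred0) (h : dgLie K).
Local Notation B := (path_dgLie char0 h).

Lemma pobj_ev_linear s : linear (fun x : B => pev h s x.1).
Proof. by move=> a x y; apply: pobj_lin1. Qed.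

Definition pobj_ev s : {linear B -> h} := mklin (pobj_ev_linear s).

Lemma pobj_ev_pr s i x : pobj_ev s (gpr B i x) = gpr h i (pobj_ev s x).
Proof. exact: pobj_pr1. Qed.

Lemma pobj_ev_d s x : pobj_ev s (dgl_d B x) = dgl_d h (pobj_ev s x).
Proof. exact: pobj_d1. Qed.

Lemma pobj_ev_br s x y :
  pobj_ev s (dgl_br x y) = dgl_br (pobj_ev s x) (pobj_ev s y).
Proof. exact: pobj_br1. Qed.

Lemma pobj_const_linear : linear (fun v : h => (pconst v, 0) : B).
Proof.
move=> a u v; congr (_, _); first exact: pconst_linear.
by rewrite -[RHS]/(a *: 0 + 0) scaler0 addr0.
Qed.

Definition pobj_const : {linear h -> B} := mklin pobj_const_linear.

Lemma pobj_const1 s v : pev h s (pobj_const v).1 = v.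
Proof. exact: pev_const. Qed.

Lemma pobj_const2 v : (pobj_const v).2 = 0.
Proof. by []. Qed.

Lemma pobj_const_pr i v : pobj_const (gpr h i v) = gpr B i (pobj_const v).
Proof.
apply: pobj_ext => s; first by rewrite pobj_pr1 !pobj_const1.
by rewrite pobj_pr2 !pobj_const2 !linear0.
Qed.

Lemma pobj_const_d v : pobj_const (dgl_d h v) = dgl_d B (pobj_const v).
Proof.
apply: pobj_ext => s; first by rewrite [RHS]pobj_d1 !pobj_const1.
rewrite [RHS]pobj_d2 !pobj_const2 [(pobj_const v).1]/(pconst v) pder_const.
by rewrite !linear0 ?subr0 ?addr0.
Qed.

Lemma pobj_const_br u v :
  pobj_const (dgl_br u v) = dgl_br (pobj_const u) (pobj_const v).
Proof.
apply: pobj_ext => s; first by rewrite [RHS]pobj_br1 !pobj_const1.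
rewrite [RHS]pobj_br2 !pobj_const2 !linear0.
by rewrite dgl_br0l dgl_br0r addr0.
Qed.

Definition ev_linf s : linf B h :=
  strict_linf (pobj_ev_pr s) (pobj_ev_d s) (pobj_ev_br s).

Definition const_linf : linf h B :=
  strict_linf pobj_const_pr pobj_const_d pobj_const_br.

Lemma ev_const s : linf_comp (ev_linf s) const_linf = linf_id h.
Proof.
apply: linf_eqP; apply: (@cword_ext _ _ _ (ev_linf s \o const_linf) idfun) => w /=.
rewrite 2!strict_mapE; congr (cword _); rewrite -map_comp -[RHS]map_id.
apply: eq_map => -[k v]; rewrite /letter_map /=; congr (_, _).
exact: pobj_const1.
Qed.

(** Constants give surjectivity. For injectivity let a + dt b be a cocycle with a(s) = d y, and let
    q be the primitive of b with q(s) = y. Then a - d q has derivative a' - d b = 0 and vanishes at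
    s, so the cocycle is the differential of q. *)
Lemma ev_quasi_iso s : quasi_iso (ev_linf s).
Proof.
move=> n; split=> [x hx dx [y hy]|y hy dy].
  rewrite taylor1_strict => xy.
  have [x1 x2] := pobj_homog hx.
  have {}xy : pev h s x.1 = dgl_d h y by rewrite -xy; apply/esym; apply: x1.
  have [q [dq qs]] := pder_primitive char0 x.2 s y.
  (* Projection to degree [n - 1] makes the primitive homogeneous and preserves its derivative and
     its value at [s], both of that degree. *)
  have [q' [dq' q's hq']] : exists q', [/\ pder char0 h q' = x.2, pev h s q' = y
      & forall t, gpr h (n - 1) (pev h t q') = pev h t q'].
    exists (pathmap (gpr h (n - 1)) q); split.
    - by apply: pev_ext => t; rewrite pder_pathmap pev_pathmap dq; apply: x2.
    - by rewrite pev_pathmap qs.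
    - by move=> t; rewrite pev_pathmap gprI eqxx.
  exists ((q', 0) : B).
    apply: pobj_ext => t; first by rewrite pobj_pr1 hq'.
    by rewrite pobj_pr2 !linear0.
  apply: pobj_ext => t; last first.
    by rewrite [RHS]pobj_d2 dq' !linear0 ?subr0 ?addr0.
  have c1 : pder char0 h x.1 = pathmap (dgl_d h) x.2.
    by apply/eqP; rewrite -subr_eq0; apply/eqP; exact: (congr1 snd dx).
  have : pev h t (x.1 - pathmap (dgl_d h) q') = pev h s (x.1 - pathmap (dgl_d h) q').
    apply: (@pder_eq0 _ char0); rewrite linearB /= c1 pder_pathmap dq'.
    by rewrite subrr.
  by rewrite !linearB /= !pev_pathmap q's xy subrr => /eqP; rewrite subr_eq0 => /eqP ->.
exists (pobj_const y); split.
- by rewrite /homog -pobj_const_pr hy.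
- by rewrite -pobj_const_d dy linear0.
exists 0; first by rewrite /homog linear0.
by rewrite taylor1_strict linear0 addr0 [pobj_ev s _]pobj_const1.
Qed.
End PathEvaluation.

#[local] Arguments dgl_br : simpl never.
#[local] Arguments dgl_d : simpl never.
#[local] Arguments mklin : simpl never.

Lemma poly_deriv_polyrel (K : fieldType) (h : dgLie K) (p dp : K -> h) :
  poly_deriv p dp -> polyrel p dp.
Proof.
case=> c [/funext -> /funext ->].
have hn n : polyrel (fun s => \sum_(i < n) s ^+ i *: c`_i)
                   (fun s => \sum_(i < n) (s ^+ i.-1 *+ i) *: c`_i).
  elim: n => [|n IH].
    have := polyrel0 h; congr polyrel; apply/funext => s; by rewrite big_ord0.
  have := polyrelD IH (polyrel_monom n c`_n).
  by congr polyrel; apply/funext => s; rewrite big_ord_recr.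
exact: hn.
Qed.

Lemma cword_homog (K : fieldType) (V : gmod K) (w : seq (letter V)) :
  gpr (symp V) (wdeg w) (cword w) = cword w.
Proof.
by rewrite -{2}(scale1r (cword w)) -[1]/(true%:R) -(eqxx (wdeg w))
  -(swscale_cword (fun m => (m == wdeg w)%:R)) swscale.unlock.
Qed.

(** * The morphism defined by a gauge flow *)

Section Defect.
Variables (K : fieldType) (char0 : [pchar K] =i pred0) (g h : dgLie K).
Variable P : {linear cbar g -> cbar h}.
Hypothesis P_delta : forall x,
  sdelta (shift 1 h) (P x) = tmapl P P (sdelta (shift 1 g) x).
Hypothesis P_deg : has_degree 0 P.

Lemma swscale_deg0 (c : int -> K) x :
  swscale (shift 1 h) c (P x) = P (swscale (shift 1 g) c x).
Proof.
move: x; apply: (@cword_ext _ _ _ (swscale (shift 1 h) c \o P)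
  (P \o swscale (shift 1 g) c)) => w /=.
rewrite swscale_cword linearZ_LR.
have <- : gpr (cbar h) (wdeg w) (P (cword w)) = P (cword w).
  by rewrite -[in RHS](cword_homog w) P_deg addr0.
move: (P _) => y; apply: (@cword_ext _ _ _ (swscale (shift 1 h) c \o
  gpr (cbar h) (wdeg w)) (c (wdeg w) \*: gpr (cbar h) (wdeg w))) => v /=.
rewrite gpr_cword linearZ_LR.
rewrite swscale_cword.
rewrite [LHS]scalerA [RHS]scalerA; congr (_ *: _).
by case: eqP => [->|_]; rewrite ?mulr1 ?mul1r ?mulr0 ?mul0r.
Qed.

Definition defect : {linear cbar g -> cbar h} := (P \o ced g) \- (ced h \o P).

Lemma defectE x : defect x = P (ced g x) - ced h (P x).
Proof. by []. Qed.

(** The two expansions of the coproduct subtract factor by factor once the sign operator is moved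
    through [P], which has degree 0. *)
Lemma defect_delta x : sdelta (shift 1 h) (defect x)
  = tmapl defect P (sdelta (shift 1 g) x)
    + tmapl (P \o swscale (shift 1 g) (sg K)) defect (sdelta (shift 1 g) x).
Proof.
rewrite defectE linearB P_delta sdelta_ced [in X in _ - X = _]sdelta_ced.
rewrite P_delta linearD; move: (sdelta _ x).
apply: (@tns_ext _ _ _ _
  (((tmapl P P \o tmapl (ced g) idfun)
    \+ (tmapl P P \o tmapl (swscale (shift 1 g) (sg K)) (ced g)))
   \- ((tmapl (ced h) idfun \o tmapl P P)
       \+ (tmapl (swscale (shift 1 h) (sg K)) (ced h) \o tmapl P P)))
  (tmapl defect P \+ tmapl (P \o swscale (shift 1 g) (sg K)) defect)) => u v /=.
rewrite !tmaplE /= tnsBl tnsBr swscale_deg0.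
by rewrite opprD addrACA.
Qed.

(** A primitive element is a sum of one-letter words, on which the differential has no bracket
    terms. *)
Lemma ceproj_ced_primitive (x : cbar h) : sdelta (shift 1 h) x = 0 ->
  ceproj h (ced h x) = - dgl_d h (ceproj h x).
Proof.
move=> dx; have [s _ hs] := @gpr_sum K (cbar h) x; rewrite hs !linear_sum.
apply: eq_bigr => k _; rewrite (gpr_primitive char0 _ dx).
have -> : word1 h k (ceproj h x) = @cword K (shift 1 h) [:: (k, ceproj h x)] by [].
by rewrite ceproj_ced ceproj_cword.
Qed.

(* On a word of which all shorter words are already known to be killed, the value of the
   defect is primitive, and the differentials squaring to zero make it a chain map. *)
Lemma ceproj_defect_chain n w : (forall v, (size v < n)%N -> defect (cword v) = 0) ->
  (size w <= n)%N ->
  dgl_d h (ceproj h (defect (cword w))) = ceproj h (defect (ced g (cword w))).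
Proof.
move=> E0 wn.
have prim := delta_eq0 defect_delta E0 wn.
rewrite -[LHS]opprK -(ceproj_ced_primitive prim) -linearN; congr (ceproj h _).
(* For E = P D - D P, the products are D E = D P D and E D = - D P D. *)
rewrite !defectE ced_ced // linear0 sub0r linearB ced_ced // subr0.
by [].
Qed.
End Defect.

Section HomotopyMorphism.
Variables (K : fieldType) (char0 : [pchar K] =i pred0) (g h : dgLie K).
Variables (H : {linear cbar g -> h}) (Ft : K -> {linear cbar g -> h}).
Hypotheses (H_deg : has_degree 0 H) (Ft_deg : forall s, has_degree 1 (Ft s)).
Hypothesis Ft_flow : forall c, poly_deriv (fun s => Ft s c)
  (fun s => - conv_d 0 H c + conv_br 1 H (Ft s) c).
Local Notation B := (path_dgLie char0 h).
Local Notation wd := (@cword K (shift 1 g)).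
Local Notation sigma := (swscale (shift 1 g) (sg K)).

(** The sign of [H] is the one for which the dt-component of the Maurer-Cartan equation reads F' = -
    d H + [H, F]. *)
Definition homotopy_mc_fun (c : cbar g) : B :=
  (mkpath (poly_deriv_polyrel (Ft_flow c)), pconst (- H c)).

Lemma mc_ev c s : pev h s (homotopy_mc_fun c).1 = Ft s c.
Proof. exact: pev_mkpath. Qed.

Lemma mc_dt c s : pev h s (homotopy_mc_fun c).2 = - H c.
Proof. exact: pev_const. Qed.

Lemma mc_der c s : pev h s (pder char0 h (homotopy_mc_fun c).1)
  = - conv_d 0 H c + conv_br 1 H (Ft s) c.
Proof.
(* The right-hand side of the flow equation is the derivative of a polynomial path, hence itself a
   polynomial path. *)
have -> : pder char0 h (homotopy_mc_fun c).1 =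
    mkpath (projT2 (cid (polyrel_derivable (poly_deriv_polyrel (Ft_flow c))))).
  apply: pder_eq; have := poly_deriv_polyrel (Ft_flow c).
  by congr polyrel; apply/funext => t; rewrite pev_mkpath.
by rewrite pev_mkpath.
Qed.

Lemma homotopy_mc_linear : linear homotopy_mc_fun.
Proof.
move=> a x y; apply: pobj_ext => s.
  by rewrite pobj_lin1 !mc_ev linearP.
by rewrite pobj_lin2 !mc_dt linearP opprD scalerN.
Qed.

Definition homotopy_mc : {linear cbar g -> B} := mklin homotopy_mc_linear.
Local Notation tau := homotopy_mc.

Lemma H_homog w : homog (wdeg w) (H (wd w)).
Proof. by rewrite /homog -[in RHS]cword_homog H_deg addr0. Qed.

Lemma Ft_homog s w : homog (wdeg w + 1) (Ft s (wd w)).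
Proof. by rewrite /homog -[in RHS]cword_homog Ft_deg. Qed.

Lemma tau_homog w : gpr B (1 + wdeg w) (tau (wd w)) = tau (wd w).
Proof.
rewrite addrC; apply: pobj_ext => s.
  by rewrite pobj_pr1 mc_ev; apply: Ft_homog.
by rewrite pobj_pr2 mc_dt addrK linearN /=; congr (- _); apply: H_homog.
Qed.

Definition tau_word (w : seq (letter (shift 1 g))) : shift 1 B := tau (wd w).

Lemma tau_word_sml : symmultilinear tau_word.
Proof. exact: (sml_comp tau (@cword_sml K (shift 1 g))). Qed.

Definition homotopy_map : {linear cbar g -> cbar B} := cofree_map tau_word_sml.
Local Notation Phi := homotopy_map.

Lemma ceproj_homotopy_map c : ceproj B (Phi c) = tau c.
Proof.
move: c; apply: (@cword_ext _ _ _ (ceproj B \o Phi) tau) => w /=.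
rewrite cofree_mapE linear_pullback.
rewrite (eq_pullback _ _ (@ceproj_cword K B)).
case: w => [|x w]; first by rewrite pullback_nil cword_nil linear0.
rewrite pullback_size1 //; exact: tau_homog.
Qed.

Lemma conv_br_cword (F : {linear cbar g -> h}) w : conv_br 1 H F (wd w)
  = unsh_sum (fun a b => sg K (wdeg a) *: dgl_br (H (wd a)) (F (wd b))) w.
Proof.
rewrite /conv_br /= -[symp_delta _ _]/(symp_delta (shift 1 g) (wd w)).
have -> : symp_delta (shift 1 g) (wd w) = sdelta (shift 1 g) (wd w).
  by rewrite sdelta.unlock.
rewrite sdelta_cword !linear_unsh_sum; apply: eq_unsh_sum => a b.
rewrite tns.unlock tmapE tliftE /=.
have -> : koszul_sign g 1 (wd a) = sg K (wdeg a) *: wd a.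
  transitivity (swscale (shift 1 g) (fun n => sg K (1 * n)) (wd a)).
    by rewrite swscale.unlock.
  by rewrite swscale_cword mul1r.
by rewrite linearZ_LR dgl_brZl.
Qed.


(** [ce_word] sees only partitions into one or two blocks. Since [x] stays in the first block, each
    pair of blocks occurs once, which replaces the factor 1/2 of the Maurer-Cartan equation. *)
Lemma ceproj_ced_homotopy_map x w : ceproj B (ced B (Phi (cword (x :: w))))
  = - dgl_d B (tau (wd (x :: w))) + unsh_sum (fun a b =>
      sg K (wdeg (x :: a) + 1) *: dgl_br (tau (wd (x :: a))) (tau (wd b))) w.
Proof.
rewrite cofree_mapE linear_pullback linear_pullback.
rewrite (eq_pullback _ _ (@ceproj_ced K B)) pullback_cons.
rewrite -[X in X + _](unsh_sum_nil_r (fun a => - dgl_d B (tau (wd (x :: a))))).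
rewrite -unsh_sumD; apply: eq_unsh_sum => a [|y b].
  rewrite pullback_nil /= cword_nil linear0 tau_homog.
  by rewrite dgl_br0r scaler0 addr0.
by rewrite pullback_size1 //= !tau_homog add0r.
Qed.

(** Once the derivative is replaced by the flow equation, the differentials of [H] cancel and only
    the bracket terms remain to be compared. *)
Lemma mc_defect_dt c s :
  pev h s (ceproj B (defect Phi c)).2 = 0.
Proof.
have lin : linear (fun c => pev h s (ceproj B (defect Phi c)).2).
  by move=> a x y; rewrite 2!linearP; apply: pobj_lin2.
move: c; apply: (@cword_ext _ _ _ (mklin lin) \0) => -[|x w].
  by rewrite cword_nil linear0.
rewrite -[LHS]/(pev h s (ceproj B (defect Phi (wd (x :: w)))).2).
rewrite defectE linearB ceproj_homotopy_map ceproj_ced_homotopy_map opprD opprK.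
have ev2D (u v : B) : pev h s (u + v).2 = pev h s u.2 + pev h s v.2 by apply: pobjD2.
have ev2N (u : B) : pev h s (- u).2 = - pev h s u.2 by apply: pobjN2.
have sumE (G : seq (letter (shift 1 g)) -> seq (letter (shift 1 g)) -> B) v :
    pev h s (unsh_sum G v).2 = unsh_sum (fun a b => pev h s (G a b).2) v.
  have l2 : linear (fun u : B => pev h s u.2) by move=> ? ? ?; apply: pobj_lin2.
  exact: (linear_unsh_sum (mklin l2)).
rewrite !ev2D ev2N sumE [pev h s (dgl_d B _).2]pobj_d2 !mc_dt mc_der.
rewrite linearN opprK.
have -> : conv_d 0 H (wd (x :: w)) = dgl_d h (H (wd (x :: w))) - H (ced g (wd (x :: w))).
  by rewrite /conv_d /= [ced]unlock /sg expr0z scale1r.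
rewrite opprB addrA addrA addrAC -!addrA addKr.
set S := unsh_sum _ w; suff -> : S = conv_br 1 H (Ft s) (wd (x :: w)).
  by rewrite addNKr addNr.
(* In [[H, F]] the letter [x] goes either to [H] or to [F]. The second case is matched, after
   exchange of [a] and [b] and antisymmetry of the bracket, with the terms where [F] takes the block
   of [x] and [H] the other one. *)
rewrite conv_br_cword unsh_sum_cons [X in _ = _ + X]unsh_sum_comm -unsh_sumD.
apply: eq_unsh_sum => a b.
rewrite pobjZ2 pobj_br2 !mc_dt !mc_ev (gscale_homog _ (Ft_homog s _)).
rewrite dgl_brZl -!scaleN1r !dgl_brZl !dgl_brZr (dgl_antisym (H_homog b) (Ft_homog s (x :: a))).
rewrite -!scaleNr scalerDr !scalerA; congr (_ *: _ + _ *: _).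
  by rewrite sgD sg1; ring.
rewrite sgsq mul1r mulrN -!sgD; congr (- _).
rewrite wdeg_cons; set i := wdeg a; set j := wdeg b.
have -> : i * j + x.1 * j + j + j * (x.1 + i + 1)
  = (i * j + x.1 * j + j) + (i * j + x.1 * j + j) + 0 by ring.
by rewrite sg_double_add.
Qed.



End HomotopyMorphism.

(** * Compatibility of the homotopy with the differentials *)

Section PathDefect.
Variables (K : fieldType) (char0 : [pchar K] =i pred0) (g h : dgLie K).
Local Notation B := (path_dgLie char0 h).
Variables (p : linf g h) (P : {linear cbar g -> cbar B}).
Hypotheses (P_delta : forall x,
    sdelta (shift 1 B) (P x) = tmapl P P (sdelta (shift 1 g) x))
  (P_deg : has_degree 0 P)
  (P_dt : forall c s, pev h s (ceproj B (defect P c)).2 = 0)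
  (P_ev0 : forall x, ev_linf char0 h 0 (P x) = p x).

(** Evaluation at 0 is strict, so it commutes with corestrictions and differentials and turns the
    defect of [P] into that of [p]. *)
Lemma path_map_ev0 x : pev h 0 (ceproj B (defect P x)).1 = 0.
Proof.
rewrite -[LHS]/(pobj_ev char0 h 0 (ceproj B (defect P x))).
rewrite -(ceproj_strict (@pobj_ev_pr _ char0 h 0)) defectE linearB.
rewrite [X in _ - X](strict_map_d (@pobj_ev_pr _ char0 h 0) (@pobj_ev_d _ char0 h 0)
  (@pobj_ev_br _ char0 h 0)).
rewrite -2![strict_map _ _]/(ev_linf char0 h 0 _) !P_ev0.
by rewrite linf_ced subrr linear0.
Qed.

Lemma path_map_d x : P (ced g x) = ced B (P x).
Proof.
apply/eqP; rewrite -subr_eq0; apply/eqP; rewrite -[LHS]/(defect P x).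
move: x; apply: (@cword_ext _ _ _ _ \0) => w; rewrite [RHS]/=.
have [n] := ubnP (size w); elim: n w => // n IH w wn.
have E0 v : (size v < n)%N -> defect P (cword v) = 0 by apply: IH.
apply: (primitive_eq0 char0).
  exact: (delta_eq0 (defect_delta P_delta P_deg) E0 wn).
have := ceproj_defect_chain char0 P_delta P_deg E0 wn.
have := path_map_ev0 (cword w); have := P_dt (cword w).
move: (ceproj B (defect P (cword w))) => r r2 r0 chain.
have dr : pder char0 h r.1 = 0.
  apply: pev_ext => s; rewrite linear0.
  have := P_dt (ced g (cword w)) s.
  by rewrite -chain [pev _ _ _]pobj_d2 r2 linear0 subr0.
apply: pobj_ext => s; last by rewrite r2 linear0.
by rewrite (pder_eq0 s 0 dr) r0 linear0.
Qed.
End PathDefect.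

Section GaugeHomotopy.
Variables (K : fieldType) (char0 : [pchar K] =i pred0) (g h : dgLie K).
Variables (p q : linf g h) (H : {linear cbar g -> h}).
Variables (Ft : K -> {linear cbar g -> h}).
Hypotheses (H_deg : has_degree 0 H) (Ft_deg : forall s, has_degree 1 (Ft s)).
Hypothesis Ft_flow : forall c, poly_deriv (fun s => Ft s c)
  (fun s => - conv_d 0 H c + conv_br 1 H (Ft s) c).
Hypotheses (Ft0 : Ft 0 = taylor p) (Ft1 : Ft 1 = taylor q).
Local Notation B := (path_dgLie char0 h).
Local Notation Phi := (homotopy_map char0 Ft_flow).

Lemma homotopy_map_delta x :
  sdelta (shift 1 B) (Phi x) = tmapl Phi Phi (sdelta (shift 1 g) x).
Proof. exact: sdelta_cofree_map. Qed.

Lemma homotopy_map_deg : has_degree 0 Phi.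
Proof. exact: cofree_map_deg. Qed.

(** Both sides are coalgebra maps with corestriction [Ft s]. The argument does not involve the
    differential of [Phi], so the case [s = 0] is available for the proof that [Phi] commutes with
    differentials. *)
Lemma ev_homotopy_map s (r : linf g h) : Ft s = taylor r -> forall x, ev_linf char0 h s (Phi x) = r x.
Proof.
move=> hr x.
apply: (@coalgebra_map_unique _ char0 _ _ (ev_linf char0 h s \o Phi) r) => y.
- rewrite [LHS]linf_sdelta homotopy_map_delta; move: (sdelta _ y).
  apply: (@tns_ext _ _ _ _ (tmapl (ev_linf char0 h s) (ev_linf char0 h s) \o tmapl Phi Phi)
    (tmapl (ev_linf char0 h s \o Phi) (ev_linf char0 h s \o Phi))) => u v /=.
  by rewrite !tmaplE.
- exact: linf_sdelta.
transitivity (pobj_ev char0 h s (homotopy_mc char0 Ft_flow y)); last first.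
  by rewrite -taylorE -hr; apply: mc_ev.
rewrite -(ceproj_homotopy_map char0 H_deg Ft_deg Ft_flow).
exact: (ceproj_strict (@pobj_ev_pr K char0 h s) (Phi y)).
Qed.

Lemma homotopy_map_d x : Phi (ced g x) = ced B (Phi x).
Proof.
apply: (path_map_d (P := Phi) homotopy_map_delta homotopy_map_deg) => [c s|c].
  exact: (mc_defect_dt char0 H_deg Ft_deg Ft_flow).
exact: (ev_homotopy_map Ft0).
Qed.

Definition gauge_linf : linf g B := mklinf homotopy_map_deg homotopy_map_d homotopy_map_delta.

Lemma gauge_linf_ev0 : linf_comp (ev_linf char0 h 0) gauge_linf = p.
Proof. by apply: linf_eqP => x; apply: ev_homotopy_map. Qed.

Lemma gauge_linf_ev1 : linf_comp (ev_linf char0 h 1) gauge_linf = q.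
Proof. by apply: linf_eqP => x; apply: ev_homotopy_map. Qed.
End GaugeHomotopy.

Lemma homotopic_path (K : fieldType) (char0 : [pchar K] =i pred0) (g h : dgLie K)
    (p q : linf g h) : homotopic p q ->
  exists r : linf g (path_dgLie char0 h),
    linf_comp (ev_linf char0 h 0) r = p /\ linf_comp (ev_linf char0 h 1) r = q.
Proof.
case=> H H_deg [Ft [Ft_deg Ft0 Ft_flow] Ft1].
exists (gauge_linf char0 H_deg Ft_deg Ft_flow Ft0).
by split; [apply: gauge_linf_ev0|apply: gauge_linf_ev1].
Qed.

(** * Functors that invert quasi-isomorphisms *)

Lemma functor_common_section (C X : category) (F : functor C X) (a b : C)
    (e e' : mor b a) (c : mor a b) :
  compm e c = idm a -> compm e' c = idm a -> invertible (fmor F e) ->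
  fmor F e = fmor F e'.
Proof.
move=> ec e'c [v [ve _]].
have Fec : compm (fmor F e) (fmor F c) = idm (F a) by rewrite -fmor_comp ec fmor_id.
have Fe'c : compm (fmor F e') (fmor F c) = idm (F a) by rewrite -fmor_comp e'c fmor_id.
(* A right inverse of the invertible [fmor F e] is its two-sided inverse; [fmor F e'] is then
   another left inverse of [v], hence equal to [fmor F e]. *)
have cv : fmor F c = v by rewrite -[LHS]comp1m -ve -compmA Fec compm1.
by rewrite -[LHS]comp1m -Fe'c -compmA cv ve compm1.
Qed.

Lemma functor_homotopic (K : fieldType) (char0 : [pchar K] =i pred0) (X : category)
    (F : functor (LieDg K) X)
    (hF : forall (g h : dgLie K) (p : linf g h), quasi_iso p -> invertible (fmor F p))
    (g1 g2 : dgLie K) (p1 p2 : linf g1 g2) :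
  homotopic p1 p2 -> fmor F p1 = fmor F p2.
Proof.
move=> /(homotopic_path char0)[r [<- <-]].
pose e s : @mor (LieDg K) (path_dgLie char0 g2) g2 := ev_linf char0 g2 s.
have e01 : fmor F (e 0) = fmor F (e 1).
  apply: (functor_common_section (c := const_linf char0 g2 : @mor (LieDg K) _ _)).
  - exact: ev_const.
  - exact: ev_const.
  - exact: hF (ev_quasi_iso char0 g2 0).
have er s := fmor_comp F (e s) (r : @mor (LieDg K) g1 (path_dgLie char0 g2)).
exact: (etrans (er 0) (etrans (congr1 (fun u => compm u (fmor F _)) e01) (esym (er 1)))).
Qed.

Theorem theorem2 (R : realType) (X : category) (F : functor (LieDg R[i]) X)
    (hF : forall (g h : dgLie R[i]) (p : linf g h),
        quasi_iso p -> invertible (fmor F p))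
    (g1 g2 : dgLie R[i]) (p1 p2 : linf g1 g2) :
  homotopic p1 p2 -> fmor F p1 = fmor F p2.
Proof. exact: (functor_homotopic (@pchar_num R[i]) hF). Qed.
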